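(* Let $\mathbb I_n$ be the set of idempotent ideals ($I^2=I$) of $\mathbb{S}_n$. (1) The map $\mathcal C_n\to\mathbb I_n$, $C\mapsto I_C:=\sum_{f\in C}I_f$ (with $I_\emptyset=0$), is a bijection. (2) $\mathbb I_n$ is finite. Its cardinality is the Dedekind number $\mathfrak d_n$, i.e. the number of antichains (families of pairwise incomparable subsets, including the empty family) in the power set of $\{1,\dots,n\}$ ordered by inclusion. (3) $\eta(I)=I$ for every idempotent ideal $I$ of $\mathbb{S}_n$.
   Context: $K$ is a field. $\mathbb{S}_n$ is the $K$-algebra generated by $x_1,\dots,x_n,y_1,\dots,y_n$ subject to the defining relations $y_ix_i=1$ for all $i$, and $[x_i,y_j]=[x_i,x_j]=[y_i,y_j]=0$ for all $i\ne j$. For each $i$, $\mathbb{S}_1(i)$ is the subalgebra generated by $x_i,y_i$, and $\mathbb{S}_n=\mathbb{S}_1(1)\otimes\cdots\otimes\mathbb{S}_1(n)$. $F(i)=\bigoplus_{k,l\in\mathbb N}K(x_i^ky_i^l-x_i^{k+1}y_i^{l+1})$ is an ideal of $\mathbb{S}_1(i)$. $\mathcal B_n$ is the set of functions $f:\{1,\dots,n\}\to\{0,1\}$, partially ordered by $f\ge g$ iff $f(i)\ge g(i)$ for all $i$. For $f\in\mathcal B_n$, set $I_f=I_{f(1)}(1)\otimes\cdots\otimes I_{f(n)}(n)$, where $I_0(i)=F(i)$ and $I_1(i)=\mathbb{S}_1(i)$. $\mathcal C_n$ is the set of subsets $C\subseteq\mathcal B_n$ whose distinct elements are pairwise incomparable.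 $\eta$ is the involution of $\mathbb{S}_n$, i.e. the $K$-algebra anti-automorphism with $\eta(x_i)=y_i$ and $\eta(y_i)=x_i$. *)

(* Defs.v *)
From HB Require Import structures.
From mathcomp Require Import all_boot all_order all_algebra.
Set Implicit Arguments. Unset Strict Implicit. Unset Printing Implicit Defensive.
Import GRing.Theory.
Local Open Scope ring_scope.

(* ---------- The algebra S_n as the monoid algebra of (bicyclic monoid)^n ----
   S_1 = K<x,y | yx = 1> has K-basis x^k y^l (k,l in nat), and
   (x^a y^b)(x^c y^d) = x^(a + (c-b)) y^((b-c) + d)   (truncated subtraction).
   S_n = S_1(1) (x) ... (x) S_1(n) has K-basis prod_i x_i^(k_i) y_i^(l_i),
   multiplied coordinatewise.  A basis monomial is encoded by i |-> (k_i,l_i). *)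

Definition mon (n : nat) := {ffun 'I_n -> nat * nat}.

Definition mmul (n : nat) (u v : mon n) : mon n :=
  [ffun i => (((u i).1 + ((v i).1 - (u i).2))%N, (((u i).2 - (v i).1) + (v i).2)%N)].

Definition mone (n : nat) : mon n := [ffun _ => (0%N, 0%N)].

(* formal finite K-linear combinations of basis monomials *)
Definition expr (K : fieldType) (n : nat) := seq (K * mon n).

(* coefficient function of a formal combination: this is the element of S_n *)
Definition ev (K : fieldType) (n : nat) (s : expr K n) : mon n -> K :=
  fun m => \sum_(p <- s | p.2 == m) p.1.

Definition emul (K : fieldType) (n : nat) (s t : expr K n) : expr K n :=
  [seq (p.1 * q.1, mmul p.2 q.2) | p <- s, q <- t].

(* Elements of S_n are the (finitely supported) coefficient functions ev s;
   subsets of S_n are predicates on functions mon n -> K. *)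
Definition elt (K : fieldType) (n : nat) (g : mon n -> K) :=
  exists s : expr K n, forall m, g m = ev s m.

Definition is_ideal (K : fieldType) (n : nat) (I : (mon n -> K) -> Prop) :=
  [/\ forall g, I g -> elt g,
      I (fun _ => 0),
      forall g h, I g -> I h -> I (fun m => g m + h m),
      forall (c : K) g, I g -> I (fun m => c * g m)
    & forall s t : expr K n, I (ev t) -> I (ev (emul s t)) /\ I (ev (emul t s))].

Definition sqI (K : fieldType) (n : nat) (I : (mon n -> K) -> Prop) (g : mon n -> K) :=
  exists (k : nat) (s t : 'I_k -> expr K n),
    (forall j, I (ev (s j)) /\ I (ev (t j))) /\
    forall m, g m = \sum_(j < k) ev (emul (s j) (t j)) m.

Definition idem_ideal (K : fieldType) (n : nat) (I : (mon n -> K) -> Prop) :=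
  forall g, sqI I g <-> I g.

Definition expr1 (K : fieldType) := seq (K * (nat * nat)).

Definition ev1 (K : fieldType) (s : expr1 K) : nat * nat -> K :=
  fun m => \sum_(p <- s | p.2 == m) p.1.

Definition Fcomb (K : fieldType) (ts : expr1 K) : expr1 K :=
  flatten [seq [:: (p.1, p.2); (- p.1, ((p.2).1.+1, (p.2).2.+1))] | p <- ts].

Definition inF (K : fieldType) (s : expr1 K) :=
  exists ts : expr1 K, forall m, ev1 s m = ev1 (Fcomb ts) m.

Definition inI1 (K : fieldType) (b : bool) (s : expr1 K) : Prop :=
  if b then True else inF s.

Definition emb (K : fieldType) (n : nat) (i : 'I_n) (s : expr1 K) : expr K n :=
  [seq (p.1, [ffun j => if j == i then p.2 else (0%N, 0%N)]) | p <- s].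

Definition tens (K : fieldType) (n : nat) (a : 'I_n -> expr1 K) : expr K n :=
  foldr (fun i acc => emul (emb i (a i)) acc) [:: (1, mone n)] (enum 'I_n).

Definition Bn (n : nat) := {ffun 'I_n -> bool}.

Definition leB (n : nat) (f g : Bn n) : bool := [forall i, f i ==> g i].

Definition If_ (K : fieldType) (n : nat) (f : Bn n) (g : mon n -> K) :=
  exists (k : nat) (c : 'I_k -> K) (a : 'I_k -> 'I_n -> expr1 K),
    (forall j i, inI1 (f i) (a j i)) /\
    forall m, g m = \sum_(j < k) c j * ev (tens (a j)) m.

Definition antichain (n : nat) (C : {set Bn n}) :=
  forall f g, f \in C -> g \in C -> f != g -> ~~ leB f g /\ ~~ leB g f.

Definition IC (K : fieldType) (n : nat) (C : {set Bn n}) (g : mon n -> K) :=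
  exists gs : Bn n -> mon n -> K,
    (forall f, f \in C -> If_ f (gs f)) /\
    forall m, g m = \sum_(f in C) gs f m.

Definition dedekind (n : nat) : nat :=
  #|[set A : {set {set 'I_n}} |
      [forall X in A, forall Y in A, (X != Y) ==> ~~ (X \subset Y)]]|.

Definition swapm (n : nat) (m : mon n) : mon n := [ffun i => ((m i).2, (m i).1)].

Definition eta_inv (K : fieldType) (n : nat) (g : mon n -> K) : mon n -> K :=
  fun m => g (swapm m).

(* Main.v *)
From Pilot Require Import Defs.
From HB Require Import structures.
From mathcomp Require Import all_boot all_order all_algebra.
From mathcomp Require Import boolp finmap zify ring.
From mathcomp Require mpoly monalg.

(* For a set W of indices let Q_W be the K-linear projection of S_n replacing
   x_i^k y_i^l by x_i^(k-l) y_i^(l-k) (truncated subtraction) for all i in W.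
   Its kernel is an ideal, since reducing x^k y^l mod xy = 1 is a homomorphism
   onto the integers, and I_f consists of the a with Q_{i} a = 0 for all i such
   that f(i) = 0.

   The point is that an idempotent ideal I with an element a such that
   Q_W a <> 0 contains I_f for f the characteristic function of W.  Let S_n act
   on K[x_i, i notin W] over the Laurent polynomials in the t_i, i in W.  As I
   is a two-sided ideal, all matrix entries of its elements are also (0,0)
   entries of its elements; these form an ideal A of the Laurent polynomial
   ring, idempotent because I is, and nonzero because Q_W a <> 0.  By the
   Hilbert basis theorem and Nakayama's lemma in a domain, A contains 1.  An
   element of I with (0,0) entry 1, compressed by the idempotent
   e = prod_(i notin W) (1 - x_i y_i) and multiplied by large powers of the y_i
   on the left and of the x_i on the right, i in W, becomes e, and e generates
   I_f.

   Given a nonzero a in I choose W maximal with Q_W a <> 0.  Then Q_W a lies in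
   I_f, hence in I, and fewer of the Q_V are nonzero at a - Q_W a than at a.  By
   induction I is the sum of the I_f that it contains. *)

Set Implicit Arguments.
Unset Strict Implicit.
Unset Printing Implicit Defensive.
Import GRing.Theory.
Local Open Scope ring_scope.

(** * Noetherian rings *)

Definition ideal_pred (R : comNzRingType) (I : R -> Prop) :=
  [/\ I 0, forall a b, I a -> I b -> I (a + b) & forall a b, I b -> I (a * b)].

(** Generation is tested against all ideals containing [s], which transports well along surjections
    and suits the Hilbert basis argument; [fin_gen_comb] recovers explicit coefficients. *)
Definition fin_gen (R : comNzRingType) (I : R -> Prop) :=
  exists2 s : seq R, (forall x, x \in s -> I x) &
    forall J, ideal_pred J -> (forall x, x \in s -> J x) ->
      forall x, I x -> J x.

Definition noetherian (R : comNzRingType) :=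
  forall I : R -> Prop, ideal_pred I -> fin_gen I.

Lemma noetherian_field (K : fieldType) : noetherian K.
Proof.
move=> I [I0 ID IM]; have [[x Ix nx]|nI] := pselect (exists2 x, I x & x != 0).
  exists [:: x]; first by move=> y; rewrite inE => /eqP ->.
  move=> J [J0 JD JM] Js y _; rewrite -[y](mulfVK nx); apply: JM; apply: Js.
  by rewrite inE.
exists [::] => // J [J0 JD JM] _ x Ix; have [->//|nx] := eqVneq x 0.
by case: nI; exists x.
Qed.

Lemma noetherian_surj (R R' : comNzRingType) (f : {rmorphism R -> R'}) :
  (forall y, exists x, f x = y) -> noetherian R -> noetherian R'.
Proof.
move=> fS nR I [I0 ID IM].
have [|s sI sG] := nR (fun x => I (f x)).
  split; first by rewrite rmorph0.
    by move=> a b Ia Ib; rewrite rmorphD; apply: ID.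
  by move=> a b Ib; rewrite rmorphM; apply: IM.
exists (map f s); first by move=> _ /mapP[x xs ->]; apply: sI.
move=> J [J0 JD JM] Js y Iy; have [x xy] := fS y.
rewrite -xy; apply: (sG (fun x => J (f x))); last by rewrite xy.
  split; first by rewrite rmorph0.
    by move=> a b Ia Ib; rewrite rmorphD; apply: JD.
  by move=> a b Ib; rewrite rmorphM; apply: JM.
by move=> z zs; apply/Js/map_f.
Qed.

(** * Hilbert's basis theorem *)

Section HilbertBasis.
Variables (R : comNzRingType) (I : {poly R} -> Prop).
Hypotheses (nR : noetherian R) (idI : ideal_pred I).

(** For [J = I] these are the coefficients of ['X^d] in the elements of [I] of degree at most [d].
    For another ideal [J] they are those attained inside both ideals, so that comparing the two
    cases measures how much of [I] lies in [J]. *)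
Let top_coef (J : {poly R} -> Prop) d c :=
  exists p, [/\ I p, J p, (size p <= d.+1)%N & p`_d = c].

Let ideal_top_coef J d : ideal_pred J -> ideal_pred (top_coef J d).
Proof.
case: idI => I0 ID IM [J0 JD JM]; split.
- by exists 0; rewrite size_poly0 coef0.
- move=> _ _ [p [Ip Jp sp <-]] [q [Iq Jq sq <-]]; exists (p + q); split.
  + exact: ID.
  + exact: JD.
  + by rewrite (leq_trans (size_polyD _ _)) // geq_max sp.
  + by rewrite coefD.
- move=> a _ [p [Ip Jp sp <-]]; exists (a%:P * p); split.
  + exact: IM.
  + exact: JM.
  + by rewrite mul_polyC (leq_trans (size_scale_leq _ _)).
  + by rewrite coefCM.
Qed.

Let top_coefS J d k c : ideal_pred J -> top_coef J d c -> top_coef J (d + k) c.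
Proof.
case: idI => I0 ID IM [J0 JD JM] [p [Ip Jp sp <-]].
exists ('X^k * p); split; [exact: IM|exact: JM| |].
  apply/leq_sizeP => j dkj; rewrite coefXnM; case: ltnP => // kj.
  by rewrite nth_default // (leq_trans sp) // leq_subRL // addnC.
by rewrite coefXnM ltnNge leq_addl /= addnK.
Qed.

(** Each of the finitely many generators of the ideal of top coefficients is lifted to a polynomial
    in [I]. *)
Let top_gen d : exists2 G : seq {poly R}, (forall p, p \in G -> I p) &
  forall J, ideal_pred J -> (forall p, p \in G -> J p) ->
    forall c, top_coef I d c -> top_coef J d c.
Proof.
have [s sI sG] := nR (ideal_top_coef d idI).
have [G GI Gs] : exists2 G : seq {poly R}, (forall p, p \in G -> I p) &
  forall J, (forall p, p \in G -> J p) ->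
    forall c, c \in s -> top_coef J d c.
  elim: s sI {sG} => [|c s IHs] sI; first by exists [::].
  have [|G GI GJ] := IHs; first by move=> x xs; apply: sI; rewrite inE xs orbT.
  have [p [Ip _ sp pc]] := sI c (mem_head _ _).
  exists (p :: G); first by move=> q /predU1P[->//|]; apply: GI.
  move=> J Js x /predU1P[->|xs].
    by exists p; split=> //; apply: Js; rewrite mem_head.
  by apply: GJ => // q qG; apply: Js; rewrite inE qG orbT.
exists G => // J idJ Js c Ic; apply: sG => //; first exact: ideal_top_coef.
by apply: Gs.
Qed.

Let top_gens D : exists2 G : seq {poly R}, (forall p, p \in G -> I p) &
  forall J, ideal_pred J -> (forall p, p \in G -> J p) ->
    forall d c, (d <= D)%N -> top_coef I d c -> top_coef J d c.
Proof.
elim: D => [|D [G GI GJ]].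
  have [G GI GJ] := top_gen 0; exists G => // J idJ Js d c.
  by rewrite leqn0 => /eqP ->; apply: GJ.
have [H HI HJ] := top_gen D.+1; exists (G ++ H).
  by move=> p; rewrite mem_cat => /orP[/GI|/HI].
move=> J idJ Js d c; rewrite leq_eqVlt => /predU1P[->|lt].
  by apply: HJ => // p pH; apply: Js; rewrite mem_cat pH orbT.
by apply: GJ => // p pG; apply: Js; rewrite mem_cat pG.
Qed.

(** The lifts in degrees up to a bound [D] generate: given [p] in [I], an element of both [I] and
    [J] with the same top coefficient is subtracted, and the size drops. *)
Lemma hilbert_basis : fin_gen I.
Proof.
have [I0 ID IM] := idI.
pose L c := exists d, top_coef I d c.
have idL : ideal_pred L.
  split; first by exists 0; have [] := ideal_top_coef 0 idI.
    move=> a b [d La] [e Lb]; exists (d + e)%N.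
    have [_ + _] := ideal_top_coef (d + e) idI.
    by apply; [|rewrite addnC]; apply: top_coefS.
  by move=> a b [d Lb]; exists d; have [_ _] := ideal_top_coef d idI; apply.
have [s sL sG] := nR idL.
(* The ideals of top coefficients increase with the degree, so one [D] serves all generators of
   their union [L]. *)
have [D LD] : exists D, forall c, c \in s -> top_coef I D c.
  elim: s sL {sG} => [|c s IHs] sL; first by exists 0.
  have [|D HD] := IHs; first by move=> x xs; apply: sL; rewrite inE xs orbT.
  have [d cd] := sL c (mem_head _ _); exists (D + d)%N => x /predU1P[->|xs].
    by rewrite addnC; apply: top_coefS.
  by apply: top_coefS => //; apply: HD.
have LLD c : L c -> top_coef I D c.
  by apply: sG => //; apply: ideal_top_coef.
have [G GI GJ] := top_gens D; exists G => // J idJ Js p Ip.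
have [J0 JD JM] := idJ.
have [k] := ubnP (size p); elim: k p Ip => // k IHk p Ip; rewrite ltnS => sp.
case: k => [|k] in IHk sp *.
  by move: sp; rewrite leqn0 size_poly_eq0 => /eqP->.
(* Beyond [D], a polynomial of degree at most [D] with the required top coefficient is shifted by a
   power of ['X]. *)
have [q [Iq Jq sq qp]] : top_coef J k p`_k.
  have [kD|/ltnW Dk] := leqP k D.
    by apply: (GJ J idJ Js) => //; exists p.
  rewrite -(subnKC Dk); apply: top_coefS => //; apply: (GJ J idJ Js) => //.
  by apply: LLD; exists k; exists p; rewrite subnKC.
rewrite -[p](subrK q); apply: JD => //; apply: IHk.
  by apply: ID => //; rewrite -mulN1r; apply: IM.
rewrite ltnS; apply/leq_sizeP => j; rewrite leq_eqVlt => /predU1P[<-|kj].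
  by rewrite coefB qp subrr.
by rewrite coefB !nth_default ?subrr // (leq_trans _ kj).
Qed.

End HilbertBasis.

Lemma noetherian_poly (R : comNzRingType) : noetherian R -> noetherian {poly R}.
Proof. by move=> nR I; apply: hilbert_basis. Qed.

(** * Explicit generators and Nakayama's lemma *)

Lemma fin_gen_comb (R : comNzRingType) (I : R -> Prop) :
  fin_gen I -> exists (k : nat) (g : 'I_k -> R), (forall i, I (g i)) /\
    forall x, I x -> exists c : 'I_k -> R, x = \sum_i c i * g i.
Proof.
move=> [s sI sG]; exists (size s), (fun i => tnth (in_tuple s) i); split.
  by move=> i; apply/sI/mem_tnth.
apply: sG.
  split; first by exists (fun _ => 0); rewrite big1 // => i; rewrite mul0r.
    move=> _ _ [c ->] [d ->]; exists (fun i => c i + d i).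
    by rewrite -big_split; apply: eq_bigr => i _; rewrite mulrDl.
  move=> a _ [c ->]; exists (fun i => a * c i).
  by rewrite big_distrr; apply: eq_bigr => i _; rewrite /= mulrA.
move=> x /(@tnthP _ _ (in_tuple s))[i ->]; exists (fun j => (j == i)%:R).
rewrite (bigD1 i) //= eqxx mul1r big1 ?addr0 // => j /negPf ->.
by rewrite mul0r.
Qed.

(** The determinant is a polynomial in the entries with coefficients 1 and -1. The intended [R] is
    congruence modulo an ideal of a subring of [F], where no quotient ring is at hand. *)
Lemma det_rel (F : comNzRingType) (R : F -> F -> Prop) (k : nat)
    (B C : 'M[F]_k) :
  R 0 0 -> R 1 1 -> R (-1) (-1) ->
  (forall x x' y y', R x x' -> R y y' -> R (x + y) (x' + y')) ->
  (forall x x' y y', R x x' -> R y y' -> R (x * y) (x' * y')) ->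
  (forall i j, R (B i j) (C i j)) -> R (\det B) (\det C).
Proof.
move=> R0 R1 RN1 RD RM RBC; rewrite /determinant.
apply: (big_ind2 R R0 RD) => s _.
apply: (RM); first by case: (perm.odd_perm s); rewrite ?expr0 ?expr1.
by apply: (big_ind2 R R1 RM) => i _; apply: RBC.
Qed.

(** The determinant trick: [1 - M] kills the nonzero vector [g], so its determinant is 0, while
    modulo [A] that determinant is congruent to 1. *)
Lemma nakayama_field (F : fieldType) (A : F -> Prop) (k : nat) (g : 'I_k -> F)
    (M : 'M[F]_k) (i0 : 'I_k) :
  (forall a b, A a -> A b -> A (a - b)) ->
  (forall a b, A a -> A b -> A (a * b)) ->
  (forall i j, A (M i j)) -> (forall i, g i = \sum_j M i j * g j) ->
  g i0 != 0 -> A 1.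
Proof.
move=> AB AM MA gM gn0; have A0 : A 0 by rewrite -(subrr (M i0 i0)); apply: AB.
have AN a : A a -> A (- a) by rewrite -sub0r; apply: AB.
have AD a b : A a -> A b -> A (a + b).
  by move=> Aa Ab; rewrite -[b]opprK; apply/AB/AN.
pose T x := forall a, A a -> A (x * a).
have det0 : \det (1%:M - M) = 0.
  apply/eqP; apply: contraNT gn0; rewrite -unitfE -unitmxE => U.
  pose G := \col_i g i.
  have : (1%:M - M) *m G = 0.
    apply/matrixP => i j; rewrite mulmxBl mul1mx !mxE gM.
    by rewrite -sumrB big1 // => l _; rewrite mxE subrr.
  move/(congr1 (mulmx (invmx (1%:M - M)))); rewrite mulKmx // mulmx0.
  by move/matrixP/(_ i0 ord0); rewrite !mxE => ->.
(* [A] is no ideal of [F]; congruence modulo [A] respects products only among the multipliers [T]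
   that map [A] into itself. *)
pose R x y := [/\ A (x - y), T x & T y].
have RM x x' y y' : R x x' -> R y y' -> R (x * y) (x' * y').
  case=> xx' Tx Tx' [yy' Ty Ty']; split.
  - rewrite (_ : _ - _ = y * (x - x') + x' * (y - y')).
      by apply: AD; [apply: Ty|apply: Tx'].
    by rewrite !mulrBr [y * x]mulrC [y * x']mulrC addrA subrK.
  - by move=> a Aa; rewrite -mulrA; apply/Tx/Ty.
  - by move=> a Aa; rewrite -mulrA; apply/Tx'/Ty'.
have T1 : T 1 by move=> a; rewrite mul1r.
have RD x x' y y' : R x x' -> R y y' -> R (x + y) (x' + y').
  case=> xx' Tx Tx' [yy' Ty Ty']; split.
  - by rewrite opprD addrACA; apply: AD.
  - by move=> a Aa; rewrite mulrDl; apply: AD; [apply: Tx|apply: Ty].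
  - by move=> a Aa; rewrite mulrDl; apply: AD; [apply: Tx'|apply: Ty'].
have R0 : R 0 0 by split=> [|a|a]; rewrite ?subrr // mul0r.
have R1 : R 1 1 by split; rewrite ?subrr.
have RN1 : R (-1) (-1).
  by split=> [|a Aa|a Aa]; rewrite ?subrr // mulN1r; apply: AN.
have RIM i j : R ((1%:M - M) i j) ((1%:M : 'M[F]_k) i j).
  rewrite !mxE; have [_ Tb _] : R (i == j)%:R (i == j)%:R by case: (i == j).
  split=> // [|a Aa].
    by rewrite addrAC subrr add0r; apply: AN.
  by rewrite mulrBl; apply: AB; [apply: Tb|apply: AM].
have := @det_rel F R k (1%:M - M) 1%:M R0 R1 RN1 RD RM RIM.
by rewrite det0 det1 => -[+ _ _]; rewrite sub0r => /AN; rewrite opprK.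
Qed.

(** * Laurent polynomials *)

Module Laurent.
Import mpoly.

Section Laurent.
Variables (K : fieldType) (n : nat).

(** Induction on the number of variables: the ring in [m.+1] variables is the image of [{poly {mpoly
    K[m]}}] under ['X] going to the last variable. *)
Lemma noetherian_mpoly m : noetherian {mpoly K[m]}.
Proof.
elim: m => [|m IHm].
  apply: (@noetherian_surj K _ (@mpolyC 0 K)); last exact: noetherian_field.
  move=> p; exists p@_0; apply/mpolyP => i; rewrite mcoeffC.
  suff -> : i = 0%MM by rewrite eqxx mulr1.
  by apply/mnmP; case.
have cX : commr_rmorph (@mwiden m K) ('X_ord_max) by move=> p; apply: mulrC.
apply: (@noetherian_surj _ _ (horner_morph cX)); last exact: noetherian_poly.
pose im q := exists p, horner_morph cX p = q.
have imD p q : im p -> im q -> im (p + q).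
  by case=> [a <-] [b <-]; exists (a + b); rewrite rmorphD.
have imM p q : im p -> im q -> im (p * q).
  by case=> [a <-] [b <-]; exists (a * b); rewrite rmorphM.
have im0 : im 0 by exists 0; rewrite rmorph0.
have im1 : im 1 by exists 1; rewrite rmorph1.
have imX i : im 'X_i.
  case: (unliftP ord_max i) => [j ->|->]; last first.
    by exists 'X; rewrite horner_morphX.
  exists ('X_j)%:P; rewrite horner_morphC /= mwidenX mnmwiden1.
  by congr 'X_[U_(_)]; apply: val_inj; rewrite /= /bump leqNgt ltn_ord.
move=> q; rewrite -/(im q) (mpolyE q); apply: (big_ind im im0 imD) => e _.
rewrite -mul_mpolyC; apply: (imM).
  by exists ((q@_e)%:MP)%:P; rewrite horner_morphC /= mwidenC.
rewrite mpolyXE_id; apply: (big_ind im im1 imM) => i _.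
elim: (e i) => [|k IHk]; first by rewrite expr0.
by rewrite exprS; apply: imM.
Qed.

Definition Fr : fieldType := {fraction {mpoly K[n]}}.

Definition cst : {rmorphism K -> Fr} := (@tofrac _) \o @mpolyC n K.

Definition var (i : 'I_n) : Fr := @tofrac {mpoly K[n]} 'X_i.

Lemma var_neq0 i : var i != 0.
Proof.
rewrite tofrac_eq0; apply/eqP => /(congr1 (mcoeff U_(i)))/eqP.
by rewrite mcoeffX mcoeff0 eqxx oner_eq0.
Qed.

(** Distinct monomials are linearly independent and [tofrac] is injective. The exponents [e m] may
    repeat, so coefficients are collected by exponent. *)
Lemma var_indep (I : Type) (r : seq I) (P : pred I) (c : I -> K)
    (e : I -> {ffun 'I_n -> nat}) :
  \sum_(m <- r | P m) cst (c m) * \prod_i var i ^+ e m i = 0 ->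
  forall e0, \sum_(m <- r | P m && (e m == e0)) c m = 0.
Proof.
move=> s0 e0; pose mn (f : {ffun 'I_n -> nat}) := [multinom f i | i < n].
have : \sum_(m <- r | P m) c m *: 'X_[mn (e m)] = 0 :> {mpoly K[n]}.
  apply/eqP; rewrite -tofrac_eq0 rmorph_sum -[X in _ == X]s0.
  apply/eqP; apply: eq_bigr => m _ /=.
  rewrite -mul_mpolyC rmorphM /= mpolyXE_id rmorph_prod; congr (_ * _).
  by apply: eq_bigr => i _; rewrite rmorphXn mnmE.
move/(congr1 (mcoeff (mn e0))); rewrite mcoeff0 raddf_sum => s1.
rewrite -[RHS]s1 big_mkcondr; apply: eq_bigr => m _ /=.
rewrite mcoeffZ mcoeffX; suff -> : (mn (e m) == mn e0) = (e m == e0).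
  by case: eqP; rewrite ?mulr1 ?mulr0.
apply/eqP/eqP => [/mnmP h|-> //]; apply/ffunP => i.
by have := h i; rewrite !mnmE.
Qed.

Variable W : {set 'I_n}.

Let tau : Fr := \prod_(i in W) var i.
(** Sending the variables outside [W] to 0 makes the image the polynomial ring in the [var i] with
    [i] in [W], without a ring indexed by [W]. *)
Let phi : {rmorphism {mpoly K[n]} -> Fr} :=
  mmap cst (fun i => if i \in W then var i else 0).

Let phiC c : phi c%:MP = cst c. Proof. exact: mmapC. Qed.

Let phiX i : phi 'X_i = if i \in W then var i else 0.
Proof. by rewrite /phi /= mmapX mmap1U. Qed.

Let tau_neq0 : tau != 0.
Proof. by apply/prodf_neq0 => i _; apply: var_neq0. Qed.

(* The ring K[t_i^(+-1), i in W], as a subset of K(t_1, ..., t_n). *)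
Definition laurent z := exists N p, tau ^+ N * z = phi p.

Lemma laurent_cst c : laurent (cst c).
Proof. by exists 0, c%:MP; rewrite mul1r phiC. Qed.

Lemma laurent0 : laurent 0.
Proof. by exists 0, 0; rewrite mulr0 rmorph0. Qed.

Lemma laurent1 : laurent 1.
Proof. by rewrite -(rmorph1 cst); apply: laurent_cst. Qed.

Let phi_tau N : phi ((\prod_(i in W) 'X_i) ^+ N) = tau ^+ N.
Proof.
rewrite rmorphXn rmorph_prod; congr (_ ^+ _).
by apply: eq_bigr => i iW; rewrite phiX iW.
Qed.

Lemma laurentD y z : laurent y -> laurent z -> laurent (y + z).
Proof.
move=> [N [p py]] [N' [q qz]]; exists (N + N')%N.
exists ((\prod_(i in W) 'X_i) ^+ N' * p + (\prod_(i in W) 'X_i) ^+ N * q).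
rewrite rmorphD !rmorphM !phi_tau -py -qz !mulrA -!exprD.
by rewrite [(N' + N)%N]addnC mulrDr.
Qed.

Lemma laurentM y z : laurent y -> laurent z -> laurent (y * z).
Proof.
move=> [N [p py]] [N' [q qz]]; exists (N + N')%N, (p * q).
by rewrite rmorphM -py -qz exprD mulrACA.
Qed.

Lemma laurent_var i : i \in W -> laurent (var i).
Proof. by move=> iW; exists 0, 'X_i; rewrite mul1r phiX iW. Qed.

Lemma laurent_varV i : i \in W -> laurent (var i)^-1.
Proof.
move=> iW; exists 1, (\prod_(j in W | j != i) 'X_j).
rewrite rmorph_prod /tau expr1 (bigD1 i) //= mulrAC divff ?var_neq0 // mul1r.
by apply: eq_bigr => j /andP[jW _]; rewrite phiX jW.
Qed.

Lemma laurentX y k : laurent y -> laurent (y ^+ k).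
Proof.
move=> Ly; elim: k => [|k IHk]; first exact: laurent1.
by rewrite exprS; apply: laurentM.
Qed.

(** Clearing denominators shows that generators of the polynomials in [A] generate [A] over the
    Laurent ring. As [A] is its own square, they are combinations of each other with coefficients in
    [A], and [nakayama_field] applies. *)
Theorem laurent_idem (A : Fr -> Prop) :
  (forall z, A z -> laurent z) ->
  (forall y z, A y -> A z -> A (y + z)) ->
  (forall c z, A z -> A (cst c * z)) ->
  (forall i z, i \in W -> A z -> A (var i * z)) ->
  (forall i z, i \in W -> A z -> A ((var i)^-1 * z)) ->
  (forall z, A z -> exists2 l : seq (Fr * Fr),
     (forall p, p \in l -> A p.1 /\ A p.2) & z = \sum_(p <- l) p.1 * p.2) ->
  (exists2 z, A z & z != 0) -> A 1.
Proof.
move=> AL AD AC AX AV A2 [z0 Az0 nz0].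
have A0 : A 0 by rewrite -(mul0r z0) -(rmorph0 cst); apply: AC.
have A_phi p z : A z -> A (phi p * z).
  move=> Az; rewrite (mpolyE p) rmorph_sum mulr_suml.
  apply: (big_ind A) => // e _; rewrite -mul_mpolyC rmorphM phiC -mulrA.
  apply: AC; rewrite mpolyXE_id rmorph_prod.
  apply: (big_rec (fun x => A (x * z))) => [|i x _ Ax]; first by rewrite mul1r.
  rewrite rmorphXn phiX -mulrA; elim: (e i) => [|k IHk]; first by rewrite mul1r.
  rewrite exprS -mulrA; case: ifP IHk => [iW|_ _]; last by rewrite mul0r.
  exact: AX.
have A_tauV N z : A z -> A (tau ^- N * z).
  move=> Az; rewrite -exprVn; elim: N => [|N IHN]; first by rewrite mul1r.
  rewrite exprS -mulrA; move: (_ * z) IHN => w Aw; rewrite /tau -prodfV.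
  apply: (big_rec (fun x => A (x * w))) => [|i x iW Ax]; first by rewrite mul1r.
  by rewrite -mulrA; apply: AV.
have tauX_neq0 N : tau ^+ N != 0 by exact: (expf_neq0 N tau_neq0).
have A_laurent y z : laurent y -> A z -> A (y * z).
  case=> N [p py] Az; have -> : y = tau ^- N * phi p.
    by rewrite -py (mulKf (tauX_neq0 N)).
  by rewrite -mulrA; apply/A_tauV/A_phi.
have AN z : A z -> A (- z).
  by rewrite -mulN1r -(rmorphN1 cst); apply: AC.
(* The preimage of [A] is an ideal of a noetherian polynomial ring. *)
have idB : ideal_pred (fun p => A (phi p)).
  split=> [|p q Ap Aq|p q Aq]; first by rewrite rmorph0.
    by rewrite rmorphD; apply: AD.
  by rewrite rmorphM; apply: A_phi.
have [k [g [Ag gG]]] := fin_gen_comb (@noetherian_mpoly n _ idB).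
have G z : A z ->
    exists2 c : 'I_k -> Fr, (forall i, laurent (c i)) &
      z = \sum_i c i * phi (g i).
  move=> Az; have [N [p pz]] := AL z Az.
  have [|c pc] := gG p.
    rewrite -pz; apply: A_laurent => //.
    by exists 0, ((\prod_(i in W) 'X_i) ^+ N); rewrite mul1r phi_tau.
  exists (fun i => tau ^- N * phi (c i)) => [i|].
    by exists N, (c i); rewrite (mulVKf (tauX_neq0 N)).
  have -> : z = tau ^- N * phi p by rewrite -pz (mulKf (tauX_neq0 N)).
  rewrite pc rmorph_sum mulr_sumr; apply: eq_bigr => i _.
  by rewrite rmorphM mulrA.
(* In a product [u * v] of elements of [A], expanding [v] in the generators with Laurent
   coefficients [d i] leaves the coefficients [d i * u], which lie in [A]. *)
have M z : A z ->
    exists c : 'I_k -> Fr, (forall i, A (c i)) /\ z = \sum_i c i * phi (g i).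
  move=> /A2[l lA ->]; elim: l lA => [|[u v] l IHl] lA.
    exists (fun=> 0); split=> //; rewrite big_nil big1 // => i _.
    by rewrite mul0r.
  have [|c [Ac cE]] := IHl.
    by move=> p pl; apply: lA; rewrite inE pl orbT.
  have [/= Au Av] := lA _ (mem_head _ _); have [d Ld dE] := G v Av.
  exists (fun i => d i * u + c i); split=> [i|].
    by apply: AD => //; apply: A_laurent.
  rewrite big_cons /= cE {1}dE mulr_sumr -big_split; apply: eq_bigr => i _ /=.
  by rewrite mulrDl mulrA [u * _]mulrC.
have [c Hc] := fin_all_exists (fun i => M _ (Ag i)).
have [i gi] : exists i, phi (g i) != 0.
  apply/existsP; apply: contraNT nz0; rewrite negb_exists => /forallP g0.
  have [d _ ->] := G z0 Az0; rewrite big1 // => i _.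
  by have /negPn/eqP-> := g0 i; rewrite mulr0.
apply: (@nakayama_field _ A k (fun i => phi (g i))
  (\matrix_(i, j) c i j) i) => //.
- by move=> a b Aa Ab; apply/AD/AN.
- by move=> a b /AL La Ab; apply: A_laurent.
- by move=> j l; rewrite mxE; case: (Hc j).
- by move=> j; rewrite {1}(proj2 (Hc j)); apply: eq_bigr => l _; rewrite mxE.
Qed.

End Laurent.
End Laurent.

(** * The algebra S_n *)

Section Monomials.
Variable n : nat.
Implicit Types (u v w m : mon n) (W Z : {set 'I_n}) (i : 'I_n).

Lemma mmulA : associative (@mmul n).
Proof.
move=> u v w; apply/ffunP => i; rewrite !ffunE /=.
by apply/eqP; rewrite xpair_eqE; apply/andP; split; apply/eqP; lia.
Qed.

Lemma mmul1m : left_id (mone n) (@mmul n).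
Proof.
by move=> u; apply/ffunP => i; rewrite !ffunE /= subn0 sub0n; case: (u i).
Qed.

Lemma mmulm1 : right_id (mone n) (@mmul n).
Proof.
move=> u; apply/ffunP => i; rewrite !ffunE /= subn0 sub0n !addn0.
by case: (u i).
Qed.

Definition red1 (p : nat * nat) := ((p.1 - p.2)%N, (p.2 - p.1)%N).

Definition redm W m : mon n := [ffun i => if i \in W then red1 (m i) else m i].

Lemma redm0 m : redm set0 m = m.
Proof. by apply/ffunP => i; rewrite ffunE inE. Qed.

Lemma redmU W W' m : redm W (redm W' m) = redm (W :|: W') m.
Proof.
apply/ffunP => i; rewrite !ffunE inE; do 2 case: ifP => //= _.
by rewrite /red1 /=; congr (_, _); lia.
Qed.

(** In each coordinate the difference of the two exponents is additive under [mmul], and on [W] the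
    reduction depends on that difference alone. *)
Lemma redm_mull W u v : redm W (mmul (redm W u) v) = redm W (mmul u v).
Proof.
apply/ffunP => i; rewrite !ffunE; case: (i \in W) => //=.
by rewrite /red1 /=; congr (_, _); lia.
Qed.

Lemma redm_mulr W u v : redm W (mmul u (redm W v)) = redm W (mmul u v).
Proof.
apply/ffunP => i; rewrite !ffunE; case: (i \in W) => //=.
by rewrite /red1 /=; congr (_, _); lia.
Qed.

Lemma redm_swap W m : redm W (swapm m) = swapm (redm W m).
Proof. by apply/ffunP => i; rewrite !ffunE; case: ifP. Qed.

Lemma swapmK : involutive (@swapm n).
Proof. by move=> m; apply/ffunP => i; rewrite !ffunE; case: (m i). Qed.

End Monomials.

(** * The ring structure on finitely supported combinations of monomials *)

Module OneSided.
Import monalg.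
Import Pilot.Defs.

Section Ext.
Variables (K : fieldType) (M : choiceType) (V : zmodType).
Variable h : M -> K -> V.

(** The additive extension of a map prescribed on multiples of monomials. The product of S_n and the
    maps [Q], [Phi], [lam], [trivpart] and [swapa] all arise in this way. *)
Definition ext (a : {malg K[M]}) := \sum_(m <- msupp a) h m (a@_m).

Hypothesis hB : forall m, {morph h m : x y / x - y}.

Let h0 m : h m 0 = 0.
Proof. by have := hB m 0 0; rewrite !subrr. Qed.

Lemma extEw (a : {malg K[M]}) (D : {fset M}) :
  (msupp a `<=` D)%fset -> ext a = \sum_(m <- D) h m (a@_m).
Proof.
move=> le; rewrite /ext (big_fset_incl _ le) // => m _.
by move/mcoeff_outdom ->.
Qed.

Lemma ext_additive : zmod_morphism ext.
Proof.
move=> a b; rewrite (extEw (msuppB_le _ _)) (extEw (fsubsetUl _ (msupp b))).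
rewrite (extEw (fsubsetUr (msupp a) _)) -sumrB; apply: eq_bigr => m _.
by rewrite mcoeffB hB.
Qed.

Lemma extU c m : ext << c *g m >> = h m c.
Proof. by rewrite (extEw msuppU_le) big_seq_fset1 mcoeffUU. Qed.

End Ext.

Lemma malg_ind (K : fieldType) (M : choiceType) (P : {malg K[M]} -> Prop) :
  P 0 -> (forall a b, P a -> P b -> P (a + b)) ->
  (forall c m, P << c *g m >>) -> forall a, P a.
Proof.
by move=> P0 PD PU a; rewrite (monalgE a); apply: (big_ind P P0 PD) => m _.
Qed.

Section Algebra.
Variables (K : fieldType) (n : nat).

Definition alg := {malg K[mon n]}.
HB.instance Definition _ := GRing.Zmodule.copy alg {malg K[mon n]}.

Definition U (c : K) (m : mon n) : alg := << c *g m >>.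

Lemma U_additive m : {morph (U^~ m) : x y / x - y}.
Proof. exact: monalgUB. Qed.

Lemma UD c d m : U (c + d) m = U c m + U d m.
Proof. exact: monalgUD. Qed.

Definition mulS_l (b : alg) (m : mon n) (c : K) : alg :=
  ext (fun m' d => U (c * d) (mmul m m')) b.

Fact mulS_key : unit. Proof. by []. Qed.

(* Locked, for otherwise failing unifications unfold the product. *)
Definition mulS : alg -> alg -> alg :=
  locked_with mulS_key (fun a b : alg => ext (mulS_l b) a).

Let mulSE a b : mulS a b = ext (mulS_l b) a.
Proof. by rewrite /mulS unlock. Qed.

Let hB m c : forall m', {morph (fun d => U (c * d) (mmul m m')) : x y / x - y}.
Proof. by move=> m' x y; rewrite mulrBr U_additive. Qed.

Let mulS_lB b m : {morph mulS_l b m : x y / x - y}.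
Proof.
move=> x y; rewrite -sumrB; apply: eq_bigr => m' _.
by rewrite mulrBl U_additive.
Qed.

Let mulSBl b : zmod_morphism (mulS^~ b).
Proof. by move=> x y; rewrite !mulSE ext_additive //; apply: mulS_lB. Qed.

Let mulSBr a : zmod_morphism (mulS a).
Proof.
move=> b b'; rewrite !mulSE -sumrB; apply: eq_bigr => m _.
by rewrite /mulS_l ext_additive.
Qed.

Let mulUU c d m m' : mulS (U c m) (U d m') = U (c * d) (mmul m m').
Proof. by rewrite mulSE extU //= /mulS_l extU. Qed.

Let morph0 (f : alg -> alg) : zmod_morphism f -> f 0 = 0.
Proof. by move=> fB; have := fB 0 0; rewrite !subrr. Qed.

Let morphD (f : alg -> alg) : zmod_morphism f -> {morph f : x y / x + y}.
Proof.
move=> fB x y; rewrite -[in LHS](opprK y) -(sub0r y) !fB morph0 //.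
by rewrite sub0r opprK.
Qed.

Let mulSDl : left_distributive mulS +%R.
Proof. by move=> a b c; rewrite (morphD (mulSBl c)). Qed.

Let mulSDr : right_distributive mulS +%R.
Proof. by move=> a b c; rewrite (morphD (mulSBr a)). Qed.

Let mul0S : left_zero 0 mulS.
Proof. by move=> a; rewrite (morph0 (mulSBl a)). Qed.

Let mulS0 : right_zero 0 mulS.
Proof. by move=> a; rewrite (morph0 (mulSBr a)). Qed.

Let mulSA : associative mulS.
Proof.
move=> a b c; elim/malg_ind: a => [|a a' IH IH'|k m]; first by rewrite !mul0S.
  by rewrite !mulSDl IH IH'.
elim/malg_ind: b => [|b b' IH IH'|k' m']; first by rewrite !(mul0S, mulS0).
  by rewrite !(mulSDl, mulSDr) IH IH'.
elim/malg_ind: c => [|c c' IH IH'|k'' m'']; first by rewrite !mulS0.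
  by rewrite !mulSDr IH IH'.
by rewrite !mulUU mulrA mmulA.
Qed.

Definition oneS : alg := locked_with mulS_key (U 1 (mone n)).

Let oneSE : oneS = U 1 (mone n).
Proof. by rewrite /oneS unlock. Qed.

Let mul1S : left_id oneS mulS.
Proof.
rewrite oneSE.
elim/malg_ind => [|a a' IH IH'|k m]; first by rewrite mulS0.
  by rewrite mulSDr IH IH'.
by rewrite mulUU mul1r mmul1m.
Qed.

Let mulS1 : right_id oneS mulS.
Proof.
rewrite oneSE.
elim/malg_ind => [|a a' IH IH'|k m]; first by rewrite mul0S.
  by rewrite mulSDl IH IH'.
by rewrite mulUU mulr1 mmulm1.
Qed.

HB.instance Definition _ := GRing.Zmodule_isPzRing.Build alg
  mulSA mul1S mulS1 mulSDl mulSDr.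

Definition X (m : mon n) : alg := U 1 m.

Lemma U_mul c d m m' : U c m * U d m' = U (c * d) (mmul m m').
Proof. exact: mulUU. Qed.

Lemma X_mul m m' : X m * X m' = X (mmul m m').
Proof. by rewrite /X U_mul mulr1. Qed.

Lemma XU m c m' : X m * U c m' = U c (mmul m m').
Proof. by rewrite U_mul mul1r. Qed.

Lemma UX m c m' : U c m' * X m = U c (mmul m' m).
Proof. by rewrite U_mul mulr1. Qed.

Lemma X1 : X (mone n) = 1.
Proof. by rewrite /X -oneSE. Qed.

Lemma alg_ind (P : alg -> Prop) :
  P 0 -> (forall a b, P a -> P b -> P (a + b)) -> (forall c m, P (U c m)) ->
  forall a, P a.
Proof. exact: malg_ind. Qed.

Implicit Types (W : {set 'I_n}) (a b : alg) (m : mon n).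

(** * The projections [Q W] and their kernels *)

Definition Q W (a : alg) : alg := ext (fun m c => U c (redm W m)) a.

Lemma Q_additive W : zmod_morphism (Q W).
Proof. by apply: ext_additive => m x y; apply: U_additive. Qed.

HB.instance Definition _ W :=
  GRing.isZmodMorphism.Build alg alg (Q W) (Q_additive W).

Lemma Q0 W : Q W 0 = 0.
Proof. exact: raddf0. Qed.

Lemma QD W a b : Q W (a + b) = Q W a + Q W b.
Proof. exact: raddfD. Qed.

Lemma QB W a b : Q W (a - b) = Q W a - Q W b.
Proof. exact: raddfB. Qed.

Lemma QU W c m : Q W (U c m) = U c (redm W m).
Proof. by rewrite /Q extU // => m' x y; apply: U_additive. Qed.

Lemma Q_set0 a : Q set0 a = a.
Proof.
elim/alg_ind: a => [|a b IHa IHb|c m]; first exact: Q0.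
  by rewrite QD IHa IHb.
by rewrite QU redm0.
Qed.

Lemma QQ W W' a : Q W (Q W' a) = Q (W :|: W') a.
Proof.
elim/alg_ind: a => [|a b IHa IHb|c m]; first by rewrite !Q0.
  by rewrite !QD IHa IHb.
by rewrite !QU redmU.
Qed.

Lemma Q_mull W a b : Q W (Q W a * b) = Q W (a * b).
Proof.
elim/alg_ind: a => [|a a' IHa IHa'|c m]; first by rewrite !(Q0, mul0r).
  by rewrite QD !mulrDl !QD IHa IHa'.
elim/alg_ind: b => [|b b' IHb IHb'|d m']; first by rewrite !mulr0.
  by rewrite !mulrDr !QD IHb IHb'.
by rewrite QU !U_mul !QU redm_mull.
Qed.

Lemma Q_mulr W a b : Q W (a * Q W b) = Q W (a * b).
Proof.
elim/alg_ind: b => [|a' b' IHa IHa'|d m']; first by rewrite !(Q0, mulr0).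
  by rewrite QD !mulrDr !QD IHa IHa'.
elim/alg_ind: a => [|b b' IHb IHb'|c m]; first by rewrite !mul0r.
  by rewrite !mulrDl !QD IHb IHb'.
by rewrite QU !U_mul !QU redm_mulr.
Qed.

(** Replacing a factor by its image under [Q W] does not change [Q W] of the product. *)
Lemma Q_ker_mul W a b c : Q W b = 0 -> Q W (a * b * c) = 0.
Proof.
move=> b0; rewrite -Q_mull -[Q W (a * b)]Q_mulr b0 mulr0 Q0 mul0r.
exact: Q0.
Qed.

Lemma Q_ker_mull W a b : Q W b = 0 -> Q W (a * b) = 0.
Proof. by move=> /(Q_ker_mul a 1); rewrite mulr1. Qed.

Lemma Q_ker_mulr W a b : Q W b = 0 -> Q W (b * a) = 0.
Proof. by move=> /(Q_ker_mul 1 a); rewrite mul1r. Qed.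

Lemma Q_ker_sub W W' a : W \subset W' -> Q W a = 0 -> Q W' a = 0.
Proof. by move=> /setUidPl <- a0; rewrite -QQ a0 Q0. Qed.

Definition xm W k : mon n :=
  [ffun i => if i \in W then (k, 0%N) else (0%N, 0%N)].
Definition ym W k : mon n :=
  [ffun i => if i \in W then (0%N, k) else (0%N, 0%N)].

(** For [p <= k] the product of [y^k] and [x^p y^q] is [y^(k-p+q)], which depends on [q - p]
    only. *)
Lemma mmul_ym_redm W k m : (forall i, i \in W -> ((m i).1 <= k)%N) ->
  mmul (ym W k) (redm W m) = mmul (ym W k) m.
Proof.
move=> le; apply/ffunP => i; rewrite !ffunE; case: ifP => //= iW.
by have {}le := le i iW; rewrite ?iW /red1 /=; congr (_, _); lia.
Qed.

(** In particular an element of the kernel of [Q W] is killed from the left by high powers of the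
    [y_i], [i] in [W], taken together. *)
Lemma eventually_ym W a :
  exists k0, forall k, (k0 <= k)%N -> X (ym W k) * Q W a = X (ym W k) * a.
Proof.
elim/alg_ind: a => [|a b [k ka] [l lb]|c m].
- by exists 0%N => k _; rewrite Q0.
- exists (k + l)%N => j le; rewrite QD !mulrDr ka ?lb //.
    exact: leq_trans (leq_addl _ _) le.
  exact: leq_trans (leq_addr _ _) le.
(* The sum of all x-exponents bounds each of them. *)
- exists (\sum_i (m i).1)%N => k le; rewrite QU !XU mmul_ym_redm // => i _.
  by rewrite (leq_trans _ le) // (bigD1 i) //= leq_addr.
Qed.

Lemma mmul_ymxm W k : mmul (ym W k) (xm W k) = mone n.
Proof.
by apply/ffunP => i; rewrite !ffunE; case: ifP => //= _; rewrite subnn.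
Qed.

End Algebra.

(** * The ideals I_f *)

Section Tensors.
Variables (K : fieldType) (n : nat).
Local Notation alg := (alg K n).
Local Notation expr := (expr K n).
Local Notation X := (X K).
Implicit Types (a b : alg) (m : mon n) (i j : 'I_n).

Definition coef a : mon n -> K := fun m => mcoeff m (a : {malg K[mon n]}).

Lemma coef0 m : coef 0 m = 0.
Proof. exact: mcoeff0. Qed.

Lemma coefD a b m : coef (a + b) m = coef a m + coef b m.
Proof. exact: mcoeffD. Qed.

Lemma coefB a b m : coef (a - b) m = coef a m - coef b m.
Proof. exact: mcoeffB. Qed.

Lemma coef_sum (I : Type) (r : seq I) (P : pred I) (F : I -> alg) m :
  coef (\sum_(i <- r | P i) F i) m = \sum_(i <- r | P i) coef (F i) m.
Proof.
by apply: (big_morph (fun a => coef a m)) => [a b|]; rewrite ?coefD ?coef0.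
Qed.

Lemma coefU c m m' : coef (U c m) m' = c *+ (m == m').
Proof. exact: mcoeffU. Qed.

Lemma coef_inj a b : coef a =1 coef b -> a = b.
Proof. by move=> ab; apply/malgP => m; apply: ab. Qed.

Lemma coefC c a m : coef (U c (mone n) * a) m = c * coef a m.
Proof.
elim/alg_ind: a => [|a b IHa IHb|d m']; first by rewrite mulr0 coef0 mulr0.
  by rewrite mulrDr !coefD IHa IHb mulrDr.
by rewrite U_mul mmul1m !coefU mulrnAr.
Qed.

Definition of_expr (s : expr) : alg := \sum_(p <- s) U p.1 p.2.

Lemma ev_of_expr s m : ev s m = coef (of_expr s) m.
Proof.
rewrite /ev big_mkcond coef_sum; apply: eq_bigr => p _.
by rewrite coefU; case: eqP.
Qed.

Definition to_expr a : expr := [seq (a@_m, m) | m <- msupp a].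

Lemma to_exprK a : of_expr (to_expr a) = a.
Proof. by rewrite /of_expr big_map [RHS]monalgE. Qed.

Lemma of_expr_emul s t : of_expr (emul s t) = of_expr s * of_expr t.
Proof.
rewrite /of_expr /emul big_allpairs_dep big_distrl /=; apply: eq_bigr => p _.
by rewrite big_distrr; apply: eq_bigr => q _; rewrite /= U_mul.
Qed.

Definition delta_mon i (q : nat * nat) : mon n :=
  [ffun j => if j == i then q else (0%N, 0%N)].

Definition embed i (s : expr1 K) : alg := \sum_(p <- s) U p.1 (delta_mon i p.2).

Lemma of_expr_emb i s : of_expr (emb i s) = embed i s.
Proof. by rewrite /of_expr /emb big_map. Qed.

Definition tensor (al : 'I_n -> expr1 K) : alg :=
  \prod_(i <- enum 'I_n) embed i (al i).

Lemma of_expr_tens al : of_expr (tens al) = tensor al.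
Proof.
rewrite /tens /tensor; elim: (enum _) => [|i r IHr] /=.
  by rewrite big_nil -X1 /of_expr big_seq1.
by rewrite of_expr_emul IHr big_cons of_expr_emb.
Qed.

(** The property that makes [Q [set i]] linear over the elements free of [x_i] and [y_i]; it passes
    to sums and products. *)
Definition commQ i a := forall b,
  Q [set i] (a * b) = a * Q [set i] b /\ Q [set i] (b * a) = Q [set i] b * a.

Lemma commQD i a b : commQ i a -> commQ i b -> commQ i (a + b).
Proof.
by move=> ta tb v; have [a1 a2] := ta v; have [b1 b2] := tb v; split;
  rewrite ?mulrDl ?mulrDr QD ?a1 ?b1 ?a2 ?b2.
Qed.

Lemma commQM i a b : commQ i a -> commQ i b -> commQ i (a * b).
Proof.
move=> ta tb v; split; first by rewrite -!mulrA (ta _).1 (tb _).1.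
by rewrite !mulrA (tb _).2 (ta _).2.
Qed.

Lemma commQ0 i : commQ i 0.
Proof. by move=> v; rewrite !(mul0r, mulr0) Q0. Qed.

Lemma commQU i c m : m i = (0%N, 0%N) -> commQ i (U c m).
Proof.
move=> mi v; elim/alg_ind: v => [|a b [a1 a2] [b1 b2]|d m'].
- by rewrite !(mul0r, mulr0, Q0).
- by split; rewrite QD ?mulrDl ?mulrDr QD ?a1 ?b1 ?a2 ?b2.
- rewrite QU !U_mul !QU; split; congr U; apply/ffunP => j; rewrite !ffunE inE;
    have [->|//] := eqVneq j i; rewrite mi /red1 /=; congr (_, _); lia.
Qed.

Lemma commQ1 i : commQ i 1.
Proof. by rewrite -(X1 K n); apply: commQU; rewrite ffunE. Qed.

Lemma embed_cons i p s : embed i (p :: s) = U p.1 (delta_mon i p.2) + embed i s.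
Proof. exact: big_cons. Qed.

Lemma commQ_embed i j s : j != i -> commQ i (embed j s).
Proof.
move=> ji; elim: s => [|p s IHs].
  by rewrite /embed big_nil; apply: commQ0.
rewrite embed_cons; apply: commQD => //; apply: commQU.
by rewrite ffunE eq_sym (negPf ji).
Qed.

(** Cutting the ordered product at [i] isolates one tensor factor; [A] and [B] stay the same when
    only the entry at [i] is changed. *)
Lemma tensor_factor i al : exists A B, [/\ commQ i A, commQ i B &
  forall al', (forall j, j != i -> al' j = al j) ->
    tensor al' = A * embed i (al' i) * B].
Proof.
have : i \in enum 'I_n by rewrite mem_enum.
rewrite /tensor; move: (enum_uniq 'I_n) => + iE; case/splitPr: iE => r1 r2.
rewrite cat_uniq /= => /and3P[_ + /andP[ir2 _]].
rewrite negb_or => /andP[ir1 _].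
exists (\prod_(j <- r1) embed j (al j)), (\prod_(j <- r2) embed j (al j)).
have trivP r : i \notin r -> commQ i (\prod_(j <- r) embed j (al j)).
  move=> ir; rewrite big_seq; apply: (big_ind (commQ i)) => [|a b|j jr].
  - exact: commQ1.
  - exact: commQM.
  - by apply: commQ_embed; apply: contraNneq ir => <-.
split; [exact: trivP|exact: trivP|move=> al' eq_al].
rewrite big_cat big_cons /= mulrA; congr (_ * _ * _).
  by apply: eq_big_seq => j jr; rewrite eq_al //; apply: contraNneq ir1 => <-.
by apply: eq_big_seq => j jr; rewrite eq_al //; apply: contraNneq ir2 => <-.
Qed.

Lemma Q_embed i s :
  Q [set i] (embed i s) = embed i [seq (p.1, red1 p.2) | p <- s].
Proof.
elim: s => [|p s IHs]; first by rewrite /embed !big_nil Q0.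
rewrite (embed_cons i p s) (QD [set i]) IHs QU.
rewrite (embed_cons i (p.1, red1 p.2)) /=.
suff -> : redm [set i] (delta_mon i p.2) = delta_mon i (red1 p.2) by [].
by apply/ffunP => j; rewrite !ffunE inE; case: eqP.
Qed.

Lemma coef_embed i s m :
  coef (embed i s) m = ev1 s (m i) *+ (delta_mon i (m i) == m).
Proof.
rewrite coef_sum /ev1 [X in X *+ _]big_mkcond -sumrMnl; apply: eq_bigr => p _.
rewrite coefU; have [<-|ne] := eqVneq (delta_mon i p.2) m.
  by rewrite !ffunE !eqxx.
case: eqP => [e|_]; last by rewrite mul0rn.
by rewrite -e (negPf ne).
Qed.

Lemma embed_ext i s s' : ev1 s =1 ev1 s' -> embed i s = embed i s'.
Proof. by move=> ss'; apply: coef_inj => m; rewrite !coef_embed ss'. Qed.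

(** The two monomials of each generator of F(i) have the same reduction and opposite
    coefficients. *)
Lemma inF_Q_embed i s : inF s -> Q [set i] (embed i s) = 0.
Proof.
case=> ts /(embed_ext i) ->; rewrite Q_embed.
elim: ts => [|p ts IHts]; first by rewrite /embed big_nil.
rewrite /Fcomb /= !embed_cons [embed _ _]IHts addr0 /= {2}/red1 /= !subSS.
by rewrite -UD subrr /U monalgU0.
Qed.

(** * The description of I_f by kernels agrees with the tensor product *)

Definition inIf (f : Bn n) a := forall i, ~~ f i -> Q [set i] a = 0.

Lemma tensor_inIf (f : Bn n) (al : 'I_n -> expr1 K) :
  (forall i, inI1 (f i) (al i)) -> inIf f (tensor al).
Proof.
move=> Hal i fi; have [A [B [tA tB ->//]]] := tensor_factor i al.
rewrite (tB _).2 (tA _).1 inF_Q_embed ?mulr0 ?mul0r //.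
by have := Hal i; rewrite (negPf fi).
Qed.

(** The product of the commuting projections [1 - Q [set i]]; it projects onto the common kernel of
    the [Q [set i]] with [i] in [r]. *)
Definition kproj (r : seq 'I_n) a := foldr (fun i b => b - Q [set i] b) a r.

Lemma kproj0 r : kproj r 0 = 0.
Proof. by elim: r => //= i r ->; rewrite Q0 subr0. Qed.

Lemma kprojD r a b : kproj r (a + b) = kproj r a + kproj r b.
Proof.
by elim: r => //= i r ->; rewrite QD opprD addrACA.
Qed.

Lemma kproj_id r a : (forall i, i \in r -> Q [set i] a = 0) -> kproj r a = a.
Proof.
elim: r => //= i r IHr H; rewrite IHr => [|j jr].
  by rewrite H ?mem_head // subr0.
by apply: H; rewrite inE jr orbT.
Qed.

Lemma kprojC r c a : kproj r (U c (mone n) * a) = U c (mone n) * kproj r a.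
Proof.
elim: r => //= i r ->.
by rewrite (commQU c (m := mone n) (i := i) _ _).1 ?ffunE // mulrBr.
Qed.

Definition mono_fac m (r : seq 'I_n) : 'I_n -> expr1 K := fun i =>
  if i \in r then [:: (1, m i); (-1, red1 (m i))] else [:: (1, m i)].

Lemma prod_X_delta_mon m (r : seq 'I_n) : uniq r ->
  \prod_(i <- r) X (delta_mon i (m i)) =
  X [ffun j => if j \in r then m j else (0%N, 0%N)].
Proof.
elim: r => [_|i r IHr] /=.
  rewrite big_nil -X1.
  by congr (OneSided.X _ _); apply/ffunP => j; rewrite !ffunE.
case/andP=> ir /IHr; rewrite big_cons => ->; rewrite X_mul.
congr (OneSided.X _ _); apply/ffunP => j; rewrite !ffunE inE.
have [->|_] /= := eqVneq j i.
  by rewrite (negPf ir) sub0n subn0 !addn0; case: (m i).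
by rewrite sub0n subn0 add0n; case: ifP => _ //; case: (m j).
Qed.

(** A monomial is a pure tensor, and [1 - Q [set i]] changes only its factor at [i]. *)
Lemma kproj_X m r : uniq r -> kproj r (X m) = tensor (mono_fac m r).
Proof.
elim: r => [_|i r IHr] /=.
  have -> : tensor (mono_fac m [::]) =
      \prod_(j <- enum 'I_n) X (delta_mon j (m j)).
    by apply: eq_bigr => j _; rewrite /mono_fac in_nil /embed big_seq1.
  rewrite (prod_X_delta_mon m (enum_uniq 'I_n)); congr (OneSided.X _ _).
  by apply/ffunP => j; rewrite ffunE mem_enum.
case/andP=> ir /IHr ->.
have [A [B [tA tB tensE]]] := tensor_factor i (mono_fac m r).
rewrite (tensE _) // (tB _).2 (tA _).1 Q_embed.
rewrite (tensE (mono_fac m (i :: r))); last first.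
  by move=> j ji; rewrite /mono_fac inE (negPf ji).
rewrite -mulrBl -mulrBr; congr (_ * _ * _).
rewrite /mono_fac mem_head (negPf ir) /= !embed_cons /embed !big_nil !addr0 /=.
by congr (_ + _); rewrite /U monalgUN.
Qed.

(** A monomial minus its reduction telescopes along the diagonal into generators of F(i). The
    auxiliary claim [H] runs the induction over the number [k] of diagonal steps. *)
Lemma inF_red1 p : inF [:: (1 : K, p); (-1, red1 p)].
Proof.
suff H k q : inF [:: (1 : K, ((q.1 + k)%N, (q.2 + k)%N)); (-1, q)].
  case: p => k l; have := H (minn k l) (red1 (k, l)); rewrite /red1 /=.
  have -> : (k - l + minn k l)%N = k by lia.
  by have -> : (l - k + minn k l)%N = l by lia.
case: q => x y /=; elim: k => [|k [ts IHk]].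
  exists [::] => m; rewrite !addn0 /ev1 !big_cons !big_nil /=.
  by case: (_ == m); rewrite ?addr0 ?subrr.
exists ((-1, ((x + k)%N, (y + k)%N)) :: ts) => m; have := IHk m.
rewrite /ev1 /Fcomb /= !big_cons big_nil /= opprK !addnS => <-.
by case: (_ == m) => /=; case: (_ == m) => /=; case: (_ == m) => /=; ring.
Qed.

(** Conversely to [tensor_inIf], an element of all the kernels is fixed by [kproj]; expanding it in
    monomials and applying [kproj] to each writes it as a combination of pure tensors from I_f. *)
Lemma IfP f (g : mon n -> K) :
  If_ f g <-> exists2 a : alg, inIf f a & g =1 coef a.
Proof.
split=> [[k [c [al [Hal gE]]]]|[a Ha ga]].
  exists (\sum_(j < k) U (c j) (mone n) * tensor (al j)).
    move=> i fi; rewrite raddf_sum big1 // => j _ /=.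
    by apply: Q_ker_mull; apply: (tensor_inIf (Hal j)).
  move=> m; rewrite gE coef_sum; apply: eq_bigr => j _.
  by rewrite coefC ev_of_expr of_expr_tens.
pose r := [seq i <- enum 'I_n | ~~ f i].
have Pa : kproj r a = a.
  by apply: kproj_id => i; rewrite mem_filter => /andP[/Ha].
pose M : seq (mon n) := msupp a.
exists (size M), (fun l : 'I_(size M) => coef a (nth (mone n) M l)).
exists (fun l : 'I_(size M) => mono_fac (nth (mone n) M l) r); split=> [l i|m].
  rewrite /mono_fac mem_filter mem_enum andbT.
  by case: (f i) => //=; apply: inF_red1.
transitivity (\sum_(m' <- M) coef a m' * coef (kproj r (X m')) m).
  rewrite ga -{1}Pa {1}(monalgE a).
  rewrite (big_morph (kproj r) (kprojD r) (kproj0 r)) coef_sum.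
  apply: eq_bigr => m' _.
  by rewrite -coefC -kprojC U_mul mmul1m mulr1.
rewrite (big_nth (mone n)) big_mkord; apply: eq_bigr => l _.
by rewrite ev_of_expr of_expr_tens kproj_X // filter_uniq // enum_uniq.
Qed.

End Tensors.

(** * Matrix entries over the Laurent polynomials *)

Lemma expr_frac (F : fieldType) (t : F) (a b c d : nat) : t != 0 ->
  (a + d = c + b)%N -> t ^+ a / t ^+ b = t ^+ c / t ^+ d.
Proof.
move=> t0 e; apply/eqP; rewrite eqr_div ?expf_neq0 // -!exprD.
by rewrite e.
Qed.

Section Phi.
Variables (K : fieldType) (n : nat) (W : {set 'I_n}).
Local Notation alg := (alg K n).
Local Notation X := (X K).
Local Notation F := (Laurent.Fr K n).
Local Notation cst := (@Laurent.cst K n).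
Local Notation var := (@Laurent.var K n).
Implicit Types (a b : alg) (m u v : mon n) (i j : 'I_n) (p q : nat * nat).

Lemma algE a : a = \sum_(m <- msupp a) U (coef a m) m.
Proof. exact: monalgE. Qed.

(* [Phi a] is the (0,0) entry of the matrix of [a] acting on K[x_i, i notin W]
   over the Laurent polynomials in the t_i, i in W. *)
Definition phi1 i p : F :=
  if i \in W then var i ^+ p.1 / var i ^+ p.2 else (p == (0%N, 0%N))%:R.

Definition Phim m := \prod_i phi1 i (m i).

Definition Phi a : F := ext (fun m c => cst c * Phim m) a.

Lemma Phi_additive : zmod_morphism Phi.
Proof. by apply: ext_additive => m x y; rewrite rmorphB mulrBl. Qed.

HB.instance Definition _ := GRing.isZmodMorphism.Build alg F Phi Phi_additive.

Lemma Phi0 : Phi 0 = 0.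
Proof. exact: raddf0. Qed.

Lemma PhiD a b : Phi (a + b) = Phi a + Phi b.
Proof. exact: raddfD. Qed.

Lemma PhiU c m : Phi (U c m) = cst c * Phim m.
Proof. by rewrite /Phi extU // => m' x y; rewrite rmorphB mulrBl. Qed.

Definition bmul p q := ((p.1 + (q.1 - p.2))%N, ((p.2 - q.1) + q.2)%N).

Lemma phi1_mul i p q : i \in W -> phi1 i (bmul p q) = phi1 i p * phi1 i q.
Proof.
move=> iW; rewrite /phi1 iW mulf_div -!exprD; apply: expr_frac.
  exact: Laurent.var_neq0.
by rewrite /=; lia.
Qed.

Lemma phi1_red1 i p : i \in W -> phi1 i (red1 p) = phi1 i p.
Proof.
move=> iW; rewrite /phi1 iW; apply: expr_frac; first exact: Laurent.var_neq0.
by rewrite /=; lia.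
Qed.

Definition trivC m := [forall i, (i \notin W) ==> (m i == (0%N, 0%N))].

Lemma trivCP m : reflect (forall i, i \notin W -> m i = (0%N, 0%N)) (trivC m).
Proof.
apply: (iffP forallP) => [H i iW|H i]; first exact/eqP/(implyP (H i)).
by apply/implyP => /H ->.
Qed.

Lemma Phim_eq0 m : ~~ trivC m -> Phim m = 0.
Proof.
rewrite negb_forall => /existsP[i]; rewrite negb_imply => /andP[iW mi].
by rewrite /Phim (bigD1 i) //= /phi1 (negPf iW) (negPf mi) mul0r.
Qed.

Lemma Phim_trivC m : trivC m ->
  Phim m = \prod_(i in W) (var i ^+ (m i).1 / var i ^+ (m i).2).
Proof.
move/trivCP=> mt; rewrite [RHS]big_mkcond; apply: eq_bigr => i _.
by rewrite /phi1; case: ifPn => // /mt ->; rewrite eqxx.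
Qed.

Lemma Phim_mull m m' : trivC m -> Phim (mmul m m') = Phim m * Phim m'.
Proof.
move/trivCP=> mt; rewrite -big_split; apply: eq_bigr => i _; rewrite ffunE /=.
have [iW|iW] := boolP (i \in W); first exact: phi1_mul.
rewrite mt //= subn0 sub0n !add0n /phi1 (negPf iW) eqxx mul1r.
by case: (m' i).
Qed.

Lemma Phi_mull m a : trivC m -> Phi (X m * a) = Phim m * Phi a.
Proof.
move=> mt; elim/alg_ind: a => [|a b IHa IHb|c m'].
- by rewrite mulr0 Phi0 mulr0.
- by rewrite mulrDr !PhiD mulrDr IHa IHb.
- by rewrite XU !PhiU Phim_mull // mulrCA.
Qed.

Lemma Phi_cst c a : Phi (U c (mone n) * a) = cst c * Phi a.
Proof.
elim/alg_ind: a => [|a b IHa IHb|d m'].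
- by rewrite mulr0 Phi0 mulr0.
- by rewrite mulrDr !PhiD mulrDr IHa IHb.
- by rewrite U_mul !PhiU mmul1m rmorphM mulrA.
Qed.

(** For [i] in [W] the product [x_i y_i] acts as 1, so the reduction is invisible to the action. *)
Lemma Phi_mulQ u v a : Phi (X u * Q W a * X v) = Phi (X u * a * X v).
Proof.
elim/alg_ind: a => [|a b IHa IHb|c m].
- by rewrite Q0.
- by rewrite QD !(mulrDr, mulrDl) !PhiD IHa IHb.
rewrite QU !XU !UX !PhiU; congr (_ * _); apply: eq_bigr => i _.
rewrite !ffunE; case: ifP => // iW.
by rewrite -!/(bmul _ _) !phi1_mul // phi1_red1.
Qed.

Lemma Phi_laurent a : Laurent.laurent W (Phi a).
Proof.
elim/alg_ind: a => [|a b La Lb|c m].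
- by rewrite Phi0; apply: Laurent.laurent0.
- by rewrite PhiD; apply: Laurent.laurentD.
rewrite PhiU; apply: Laurent.laurentM; first exact: Laurent.laurent_cst.
apply: (big_ind (@Laurent.laurent K n W)) => [|x y Lx Ly|i _].
- exact: Laurent.laurent1.
- exact: Laurent.laurentM.
rewrite /phi1; case: ifP => iW.
  rewrite -exprVn; apply: Laurent.laurentM; apply: Laurent.laurentX.
    exact: Laurent.laurent_var.
  exact: Laurent.laurent_varV.
by case: eqP => _; [apply: Laurent.laurent1|apply: Laurent.laurent0].
Qed.

(** The index of the only row in which column 0 of the matrix of [m] can be nonzero. *)
Definition xpart m : mon n :=
  [ffun i => if i \in W then (0%N, 0%N) else ((m i).1, 0%N)].

(** The matrix product for monomials: column 0 of [m'] has at most one nonzero entry, in row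
    [xpart m']. By [Phim_xpart] the other rows contribute nothing. *)
Lemma Phim_split m m' : Phim (mmul m m') =
  Phim (mmul m (xpart m')) * Phim (mmul (swapm (xpart m')) m').
Proof.
rewrite -big_split; apply: eq_bigr => i _; rewrite !ffunE /= -!/(bmul _ _).
case: ifP => iW.
  rewrite phi1_mul // /bmul /= !(subn0, sub0n, addn0, add0n).
  by case: (m i) (m' i) => [k l] [].
rewrite /phi1 iW; case: (m i) (m' i) => [k l] [k' l'] /=.
rewrite -natrM mulnb !xpair_eqE /=; congr (nat_of_bool _)%:R; lia.
Qed.

Lemma Phim_xpart m m' :
  Phim (mmul (swapm (xpart m)) m') != 0 -> xpart m = xpart m'.
Proof.
have [/trivCP t _|/Phim_eq0 ->] := boolP (trivC (mmul (swapm (xpart m)) m')).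
  apply/ffunP => i; rewrite !ffunE; case: ifPn => // iW.
  by have := t i iW; rewrite !ffunE (negPf iW) /= => -[*]; congr (_, _); lia.
by rewrite eqxx.
Qed.

(* A matrix product: column [u] of [a] is column 0 of [a * X u], row [u] of [b]
   is row 0 of [X (swapm u) * b], and [s] contains all [u] whose entry in column
   0 of [b] is nonzero. *)
Lemma Phi_mul a b : exists s : seq (mon n),
  Phi (a * b) = \sum_(u <- s) Phi (a * X u) * Phi (X (swapm u) * b).
Proof.
pose s := undup [seq xpart m | m <- (msupp b : seq (mon n))]; exists s.
have H a' d m' : xpart m' \in s ->
    Phi (a' * U d m') =
    \sum_(u <- s) Phi (a' * X u) * Phi (X (swapm u) * U d m').
  move=> m's; elim/alg_ind: a' => [|a' b' IHa IHb|c m].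
  - by rewrite mul0r Phi0 big1 // => u _; rewrite mul0r Phi0 mul0r.
  - rewrite mulrDl PhiD IHa IHb -big_split; apply: eq_bigr => u _.
    by rewrite /= mulrDl PhiD mulrDl.
  rewrite (bigD1_seq (xpart m')) ?undup_uniq //= big_seq_cond big1 ?addr0.
    by rewrite U_mul UX XU !PhiU rmorphM Phim_split mulrACA.
  move=> u /andP[]; rewrite mem_undup => /mapP[m1 _ ->] ne.
  rewrite UX XU !PhiU; suff -> : Phim (mmul (swapm (xpart m1)) m') = 0.
    by rewrite !mulr0.
  by apply/eqP; apply: contraNT ne => /Phim_xpart ->.
rewrite {1}[b]algE mulr_sumr raddf_sum /=.
transitivity (\sum_(m <- msupp b) \sum_(u <- s)
    Phi (a * X u) * Phi (X (swapm u) * U (coef b m) m)).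
  apply: eq_big_seq => m mb; apply: H.
  by rewrite mem_undup; apply: map_f.
rewrite exchange_big; apply: eq_bigr => u _.
by rewrite -mulr_sumr -raddf_sum -mulr_sumr -algE.
Qed.

(* [Phi a] lifted to S_n. *)
Definition lam a : alg :=
  ext (fun m c => if trivC m then U c (redm W m) else 0) a.

Let lamB m :
  {morph (fun c : K => if trivC m then U c (redm W m) else 0) : x y / x - y}.
Proof. by move=> x y; case: ifP => _; [apply: U_additive|rewrite subr0]. Qed.

Lemma lam_additive : zmod_morphism lam.
Proof. exact: ext_additive. Qed.

Lemma lamU c m : lam (U c m) = if trivC m then U c (redm W m) else 0.
Proof. by rewrite /lam extU. Qed.

Lemma coef_lam a m0 : coef (lam a) m0 =
  \sum_(m <- msupp a | trivC m && (redm W m == m0)) coef a m.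
Proof.
rewrite /lam /ext coef_sum [RHS]big_mkcond; apply: eq_bigr => m _.
by case: (trivC m) => /=; rewrite ?coef0 // coefU; case: eqP.
Qed.

(** Laurent monomials are linearly independent: multiplication by a power of the product of the
    [var i], [i] in [W], clears denominators and reduces the claim to [var_indep]. *)
Lemma lam_eq0 a : Phi a = 0 -> lam a = 0.
Proof.
move=> a0; apply: coef_inj => m0; rewrite coef_lam coef0.
pose N := (\sum_(m <- msupp a) \sum_i (m i).2)%N.
have leN m i : m \in msupp a -> ((m i).2 <= N)%N.
  move=> ma; rewrite /N (big_fsetD1 m) //= (bigD1 i) //=.
  by rewrite -addnA leq_addr.
(* The exponents after clearing denominators. As [N] bounds every y-exponent in [a], the truncated
   subtraction is exact, and on monomials trivial outside [W] the value of [e] determines the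
   reduction. *)
pose e m : {ffun 'I_n -> nat} :=
  [ffun i => if i \in W then (N + (m i).1 - (m i).2)%N else 0%N].
have [/hasP[m1 m1a /andP[m1t /eqP m1E]]|no] :=
    boolP (has (fun m => trivC m && (redm W m == m0)) (msupp a)); last first.
  rewrite big_seq_cond big1 // => m /andP[ma mP].
  by case/hasP: no; exists m.
have : \sum_(m <- msupp a | (m \in msupp a) && trivC m)
    cst (coef a m) * \prod_i var i ^+ e m i = 0.
  transitivity ((\prod_(i in W) var i) ^+ N * Phi a); last first.
    by rewrite a0 mulr0.
  rewrite -big_seq_cond /Phi /ext mulr_sumr [LHS]big_mkcond.
  apply: eq_big_seq => m ma; case: ifPn => [mt|mt]; last first.
    by rewrite Phim_eq0 // !mulr0.
  rewrite mulrCA; congr (_ * _); rewrite Phim_trivC // -prodrXl -big_split.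
  rewrite [RHS]big_mkcond; apply: eq_bigr => i _; rewrite ffunE.
  case: ifP => // iW; rewrite /= mulrA -exprD.
  have := @expr_frac _ (var i) (N + (m i).1 - (m i).2) 0 (N + (m i).1) (m i).2
    (Laurent.var_neq0 K i).
  rewrite expr0 divr1; apply; rewrite addn0 subnK //.
  by rewrite (leq_trans (leN m i ma)) // leq_addr.
move/Laurent.var_indep/(_ (e m1)) => s0.
rewrite -[RHS]s0 [LHS]big_seq_cond; apply: eq_bigl => m.
have [ma|//] /= := boolP (m \in msupp a); have [mt|//] /= := boolP (trivC m).
rewrite -m1E; apply/eqP/eqP => /ffunP H; apply/ffunP => i; have := H i.
  rewrite !ffunE; case: ifP => // iW; have := leN m i ma; have := leN m1 i m1a.
  by rewrite /red1; move=> ? ? [*]; lia.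
rewrite !ffunE; case: ifPn => iW; last first.
  by rewrite (trivCP _ mt) // (trivCP _ m1t).
have := leN m i ma; have := leN m1 i m1a.
by rewrite /red1; move=> ? ? ?; congr (_, _); lia.
Qed.

(** Among the monomials of [Q W a] let [m0] have the least total y-degree outside [W]. The [u] and
    [v] made from its exponents there cancel it exactly, and no other monomial contributes to the
    coefficient at the W-part [m1] of [m0]. *)
Lemma Phi_neq0 a : Q W a != 0 -> exists u v, Phi (X u * a * X v) != 0.
Proof.
move=> b0; pose b := Q W a; pose wt m := (\sum_(i in ~: W) (m i).2)%N.
have exk : exists k, has (fun m => wt m == k) (msupp b : seq (mon n)).
  have [m mb] : exists m, m \in msupp b.
    apply: contrapT => no; case/eqP: b0; apply: coef_inj => m; rewrite coef0.
    by apply: mcoeff_outdom; apply/negP => mb; apply: no; exists m.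
  by exists (wt m); apply/hasP; exists m.
case: (ex_minnP exk) => k0 /hasP[m0 m0b /eqP m0k] k0min.
have minw m : m \in msupp b -> (wt m0 <= wt m)%N.
  by move=> mb; rewrite m0k; apply: k0min; apply/hasP; exists m.
pose u : mon n := [ffun i => if i \in W then (0, 0)%N else (0, (m0 i).1)%N].
pose v : mon n := [ffun i => if i \in W then (0, 0)%N else ((m0 i).2, 0)%N].
exists u, v; rewrite -Phi_mulQ -/b.
pose m1 : mon n := [ffun i => if i \in W then m0 i else (0, 0)%N].
have redb m : m \in msupp b -> redm W m = m.
  rewrite -mcoeff_neq0 -/(coef b m) /b /Q /ext coef_sum => nz.
  have [m' ->] : exists m', m = redm W m'.
    apply: contrapT => no; case/eqP: nz; apply: big1 => m' _.
    rewrite coefU; case: eqP => // e; case: no; exists m'.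
    by rewrite e.
  by rewrite redmU setUid.
have uvm m : m \in msupp b -> trivC (mmul (mmul u m) v) &&
    (redm W (mmul (mmul u m) v) == m1) = (m == m0).
  move=> mb; apply/andP/eqP => [[/trivCP t /eqP r]|->]; last first.
    split; first by apply/trivCP => i iW; rewrite !ffunE (negPf iW) /=;
      congr (_, _); lia.
    apply/eqP/ffunP => i; rewrite !ffunE; have /ffunP/(_ i) := redb _ m0b.
    rewrite ffunE; case: ifP => iW /= r0; last by congr (_, _); lia.
    by rewrite !add0n !subn0 !addn0 -[RHS]r0 /red1 /=; congr (_, _); lia.
  (* If [u m v] is trivial outside [W], the exponents of [m] there fall short of those of [m0] by
     equal amounts for x and y. Minimality makes these amounts 0. *)
  have le i : i \in ~: W -> ((m i).2 <= (m0 i).2)%N.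
    rewrite inE => iW; have := t i iW.
    by rewrite !ffunE (negPf iW) /= => -[*]; lia.
  have eqw : (\sum_(i in ~: W) (m i).2 = \sum_(i in ~: W) (m0 i).2)%N.
    by apply/eqP; rewrite eqn_leq minw // andbT; apply: leq_sum.
  have eq2 i : i \in ~: W -> (m i).2 = (m0 i).2.
    move=> iW; apply/eqP; rewrite eqn_leq le // leqNgt; apply/negP => lt.
    move: eqw; rewrite (bigD1 i) // [RHS](bigD1 i) //= => /eqP.
    apply/negP; rewrite neq_ltn; apply/orP; left.
    by rewrite -addSn leq_add // leq_sum // => j /andP[jW _]; apply: le.
  apply/ffunP => i; have [iW|iW] := boolP (i \in W).
    have /ffunP/(_ i) := r; rewrite !ffunE iW /=.
    have /ffunP/(_ i) := redb _ mb; rewrite !ffunE iW /red1 /=.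
    case: (m i) => k l /=; rewrite !add0n !subn0 !addn0 => -[? ?].
    by case: (m0 i) => k' l' [*]; congr (_, _); lia.
  have := eq2 i; rewrite inE => /(_ iW); have := t i iW.
  rewrite !ffunE (negPf iW) /=; case: (m i) (m0 i) => k l [k' l'] /= [*].
  by congr (_, _); lia.
apply/eqP => /lam_eq0 /(congr1 (fun x : alg => coef x m1)).
suff -> : coef (lam (X u * b * X v)) m1 = coef b m0.
  by apply/eqP; rewrite coef0 mcoeff_neq0.
rewrite [b in LHS]algE mulr_sumr mulr_suml.
have -> : lam (\sum_(m <- msupp b) X u * U (coef b m) m * X v) =
    \sum_(m <- msupp b) lam (U (coef b m) (mmul (mmul u m) v)).
  have lam0 : lam 0 = 0 by have := lam_additive 0 0; rewrite !subrr.
  have lamD x y : lam (x + y) = lam x + lam y.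
    rewrite -[in LHS](opprK y) lam_additive -[- y]sub0r lam_additive lam0.
    by rewrite sub0r opprK.
  rewrite (big_morph lam lamD lam0); apply: eq_bigr => m _.
  by rewrite XU UX.
rewrite coef_sum (big_fsetD1 m0) //= big_seq big1 ?addr0 => [|m].
  rewrite lamU; have := uvm _ m0b; rewrite eqxx => /andP[-> /eqP ->].
  by rewrite coefU eqxx.
rewrite in_fsetD1 => /andP[ne mb]; rewrite lamU; have := uvm _ mb.
rewrite (negPf ne); case: ifP => _ /=; rewrite ?coef0 //.
by rewrite coefU => ->.
Qed.

End Phi.

(** * Idempotent ideals *)

Section Idem.
Variables (K : fieldType) (n : nat).
Local Notation alg := (alg K n).
Local Notation X := (X K).
Implicit Types (a b v : alg) (m : mon n) (i j : 'I_n) (W : {set 'I_n}).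

(* The matrix unit E_00 of F(i). *)
Definition gap i : alg := 1 - X (xm [set i] 1) * X (ym [set i] 1).
Definition gaps (r : seq 'I_n) : alg := \prod_(i <- r) gap i.

Lemma X_comm (m m' : mon n) :
  (forall i, m i = (0%N, 0%N) \/ m' i = (0%N, 0%N)) -> GRing.comm (X m) (X m').
Proof.
move=> H; rewrite /GRing.comm !X_mul; congr (OneSided.X _ _); apply/ffunP => i.
by rewrite !ffunE; have [->|->] := H i;
  rewrite /= !(subn0, sub0n, addn0, add0n).
Qed.

Lemma gap_comm i m : m i = (0%N, 0%N) -> GRing.comm (X m) (gap i).
Proof.
move=> mi; apply: commrB; first exact: commr1.
by apply: commrM; apply: X_comm => j; rewrite !ffunE inE;
  have [->|_] := eqVneq j i; [left|right|left|right].
Qed.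

Lemma gaps_comm r m : (forall i, i \in r -> m i = (0%N, 0%N)) ->
  GRing.comm (X m) (gaps r).
Proof.
move=> H; rewrite /gaps big_seq.
apply: (big_ind (GRing.comm (X m))) => [|a b|i ir].
- exact: commr1.
- exact: commrM.
- by apply: gap_comm; apply: H.
Qed.

Lemma yx1 i k : X (ym [set i] k) * X (xm [set i] k) = 1.
Proof. by rewrite X_mul mmul_ymxm X1. Qed.

Lemma gap_x i : gap i * X (xm [set i] 1) = 0.
Proof. by rewrite /gap mulrBl mul1r -mulrA (yx1 i 1) mulr1 subrr. Qed.

Lemma y_gap i : X (ym [set i] 1) * gap i = 0.
Proof. by rewrite /gap mulrBr mulr1 mulrA (yx1 i 1) mul1r subrr. Qed.

Lemma gaps_x r i : i \in r -> gaps r * X (xm [set i] 1) = 0.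
Proof.
rewrite /gaps; elim: r => // j r IHr; rewrite inE big_cons -mulrA.
have [/IHr -> _|ir] := boolP (i \in r); first by rewrite mulr0.
rewrite orbF => /eqP ij; rewrite -ij -(gaps_comm (r := r)).
  by rewrite mulrA gap_x mul0r.
by move=> l lr; rewrite !ffunE inE; case: eqP ir => // <-; rewrite lr.
Qed.

Lemma y_gaps r i : i \in r -> X (ym [set i] 1) * gaps r = 0.
Proof.
rewrite /gaps; elim: r => // j r IHr; rewrite inE big_cons mulrA.
have [<- _|ij] /= := eqVneq i j; first by rewrite y_gap mul0r.
move=> ir; rewrite gap_comm; last by rewrite !ffunE inE eq_sym (negPf ij).
by rewrite -mulrA IHr // mulr0.
Qed.

(** Since [gaps r] kills [x_i] on its right, multiplying it by [gap i] changes nothing for [i] in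
    [r]. *)
Lemma gaps_idem r : gaps r * gaps r = gaps r.
Proof.
suff H s : {subset s <= r} -> gaps r * gaps s = gaps r by apply: H.
elim: s => [|i s IHs] sr; first by rewrite /gaps big_nil mulr1.
rewrite {2}/gaps big_cons mulrA mulrBr mulr1 mulrA gaps_x ?sr ?mem_head //.
by rewrite mul0r subr0 IHs // => j js; apply: sr; rewrite inE js orbT.
Qed.

Definition trivpart W a : alg :=
  ext (fun m c => if trivC W m then U c m else 0) a.

Lemma trivpartU W c m : trivpart W (U c m) = if trivC W m then U c m else 0.
Proof.
rewrite /trivpart extU // => m' x y.
by case: ifP => _; [apply: U_additive|rewrite subr0].
Qed.

Lemma trivpart_additive W : zmod_morphism (trivpart W).
Proof.
apply: ext_additive => m x y; case: ifP => _; [exact: U_additive|].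
by rewrite subr0.
Qed.

HB.instance Definition _ W :=
  GRing.isZmodMorphism.Build alg alg (trivpart W) (trivpart_additive W).

Lemma Q_trivpart W a : Q W (trivpart W a) = lam W a.
Proof.
have lam0 : lam W 0 = 0 :> alg.
  by have := lam_additive W (0 : alg) 0; rewrite !subrr.
elim/alg_ind: a => [|a b IHa IHb|c m].
- by rewrite (raddf0 (trivpart W)) Q0 lam0.
- rewrite (raddfD (trivpart W)) QD IHa IHb.
  rewrite -[b in RHS]opprK lam_additive -[- b]sub0r lam_additive lam0.
  by rewrite sub0r opprK.
by rewrite trivpartU lamU; case: ifP => _; rewrite ?QU ?Q0.
Qed.

(** A monomial nontrivial at some [i] outside [W] has a left factor [x_i] or a right factor [y_i],
    and the neighbouring [gaps] kills it. *)
Lemma gaps_sandwich W a :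
  gaps (enum (~: W)) * a * gaps (enum (~: W)) =
  gaps (enum (~: W)) * trivpart W a * gaps (enum (~: W)).
Proof.
elim/alg_ind: a => [|a b IHa IHb|c m]; first by rewrite (raddf0 (trivpart W)).
  by rewrite (raddfD (trivpart W)) !(mulrDr, mulrDl) IHa IHb.
rewrite trivpartU; case: ifPn => // /forallPn[i]; rewrite negb_imply.
case/andP => iW mi; rewrite mulr0 mul0r.
have ir : i \in enum (~: W) by rewrite mem_enum inE.
case E1 : (m i).1 => [|k].
  have l0 : (0 < (m i).2)%N.
    by move: mi E1; case: (m i) => k l /=; rewrite xpair_eqE negb_and => + e;
      rewrite e eqxx lt0n.
  have -> : U c m =
      U c [ffun j => if j == i then ((m i).1, (m i).2.-1) else m j] *
      X (ym [set i] 1).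
    rewrite UX; congr U; apply/ffunP => j; rewrite !ffunE inE.
    have [->|_] /= := eqVneq j i; last by rewrite !subn0 !addn0; case: (m j).
    by move: l0; case: (m i) => p q /= q0; congr (_, _); lia.
  by rewrite -!mulrA (y_gaps ir) !mulr0.
have -> : U c m = X (xm [set i] 1) *
    U c [ffun j => if j == i then ((m i).1.-1, (m i).2) else m j].
  rewrite XU; congr U; apply/ffunP => j; rewrite !ffunE inE.
  have [->|_] /= := eqVneq j i.
    by move: E1; case: (m i) => p q /= q0; congr (_, _); lia.
  by rewrite subn0 sub0n !add0n; case: (m j).
by rewrite !mulrA (gaps_x ir) !mul0r.
Qed.

(** * Ideals of S_n and the I_f they contain *)

Definition ideal (I : alg -> Prop) :=
  [/\ I 0, forall a b, I a -> I b -> I (a + b)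
    & forall a b c, I b -> I (a * b * c)].

Definition idem (I : alg -> Prop) := forall a, I a ->
  exists2 l : seq (alg * alg), (forall p, p \in l -> I p.1 /\ I p.2) &
    a = \sum_(p <- l) p.1 * p.2.

Section Ideal.
Variables (I : alg -> Prop) (idI : ideal I).

Lemma ideal_mull a b : I b -> I (a * b).
Proof. by case: idI => _ _ H /(H a b 1); rewrite mulr1. Qed.

Lemma ideal_mulr a b : I b -> I (b * a).
Proof. by case: idI => _ _ H /(H 1 b a); rewrite mul1r. Qed.

Lemma idealB a b : I a -> I b -> I (a - b).
Proof.
case: idI => _ D _ Ia Ib; apply: D => //; rewrite -mulN1r.
exact: ideal_mull.
Qed.

(** From [1 = gap i + x_i y_i], [v] is [gap i * v] plus [x_i] times [y_i v], and [y_i v] is killed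
    by a smaller power of [y_i]. The factor [c] accumulates the gaps already split off. With [c = 1]
    this shows that e generates I_f. *)
Lemma ideal_gaps r (c v : alg) : uniq r ->
  (forall i, i \in r -> GRing.comm c (X (xm [set i] 1))) ->
  I (c * gaps r) ->
  (forall i, i \in r -> exists k, X (ym [set i] k) * v = 0) -> I (c * v).
Proof.
elim: r c v => [|i r IHr] c v.
  by rewrite /gaps big_nil mulr1 => *; apply: ideal_mulr.
case/andP=> ir ur cx; rewrite {1}/gaps big_cons mulrA => Icr nv.
have IH v' : (forall j, j \in r -> exists k, X (ym [set j] k) * v' = 0) ->
    I (c * gap i * v').
  move=> nv'; apply: IHr => // j jr; apply/commr_sym/commrM.
    by apply/commr_sym/cx; rewrite inE jr orbT.
  apply: gap_comm; rewrite ffunE inE.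
  by case: eqP => // e; rewrite e jr in ir.
have [k] := nv i (mem_head _ _).
have {}nv j : j \in r -> exists k, X (ym [set j] k) * v = 0.
  by move=> jr; apply: nv; rewrite inE jr orbT.
elim: k v nv => [|k IHk] v nv.
  have -> : ym [set i] 0 = mone n by apply/ffunP => j; rewrite !ffunE if_same.
  rewrite X1 mul1r => ->; rewrite mulr0; by case: idI.
move=> vk; have -> : c * v =
    c * gap i * v + X (xm [set i] 1) * (c * (X (ym [set i] 1) * v)).
  rewrite -mulrA mulrBl mul1r mulrBr !mulrA (cx i (mem_head _ _)).
  by rewrite subrK.
case: (idI) => _ D _; apply: D; first exact: IH.
apply: ideal_mull; apply: IHk => [j jr|].
  have [l vl] := nv j jr; exists l; rewrite mulrA X_comm.
    by rewrite -mulrA vl mulr0.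
  move=> s; rewrite !ffunE !inE; case: eqP => [->|_]; [right|by left].
  by case: eqP => // e; rewrite -e jr in ir.
rewrite mulrA X_mul -[RHS]vk; congr (OneSided.X _ _ * _); apply/ffunP => j.
by rewrite !ffunE; case: ifP => //= _; congr (_, _); lia.
Qed.

Lemma ideal_unit_entry W a (f : Bn n) : (forall i, f i = (i \in W)) ->
  I a -> lam W a = 1 -> forall b, inIf f b -> I b.
Proof.
move=> fW Ia a1 v fv; pose r := enum (~: W).
have rW i : i \in r -> i \notin W by rewrite mem_enum inE.
(* Compression by [gaps r] leaves the part of [a] supported on [W], whose image under [Q W] is 1;
   high powers [y^k] cannot tell it from 1, and [x^k] on the right then cancels [y^k]. *)
have Ir : I (gaps r).
  have : Q W (trivpart W a - 1) = 0.
    rewrite QB Q_trivpart a1 -(X1 K n) QU; apply/eqP; rewrite subr_eq0.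
    apply/eqP; congr U; apply/ffunP => i; rewrite !ffunE; by case: ifP.
  case: (eventually_ym W (trivpart W a - 1)) => k /(_ k (leqnn _)) + q0.
  rewrite q0 mulr0 mulrBr mulr1 => /esym/eqP; rewrite subr_eq0 => /eqP yk.
  have cy : GRing.comm (X (ym W k)) (gaps r).
    by apply: gaps_comm => i /rW /negPf iW; rewrite ffunE iW.
  have : I (X (ym W k) * (gaps r * a * gaps r) * X (xm W k)).
    by case: idI => _ _ M; apply: (M); apply: (M).
  rewrite gaps_sandwich -/r !mulrA cy -[gaps r * X _ * _]mulrA yk.
  rewrite -[gaps r * X _ * gaps r]mulrA cy mulrA gaps_idem -mulrA X_mul.
  by rewrite mmul_ymxm X1 mulr1.
rewrite -[v]mul1r; apply: (@ideal_gaps r) => //; first exact: enum_uniq.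
- by move=> i _; apply/commr_sym/commr1.
- by rewrite mul1r.
- move=> i /rW iW; have [k /(_ k (leqnn _)) H] := eventually_ym [set i] v.
  by exists k; rewrite -H fv ?mulr0 // fW.
Qed.

Hypothesis idemI : idem I.

Theorem idem_If W a (f : Bn n) : (forall i, f i = (i \in W)) ->
  I a -> Q W a != 0 -> forall b, inIf f b -> I b.
Proof.
move=> fW Ia /Phi_neq0[u [v uav]].
have [I0 ID IM] := idI.
(* [A] is the ideal of all matrix entries of elements of [I]. *)
pose A z := exists2 b, I b & z = Phi W b.
have : A 1.
  apply: (@Laurent.laurent_idem K n W A).
  - by move=> _ [b _ ->]; apply: Phi_laurent.
  - by move=> _ _ [b Ib ->] [c Ic ->]; exists (b + c); [exact: ID|rewrite PhiD].
  - move=> c _ [b Ib ->]; exists (U c (mone n) * b); first exact: ideal_mull.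
    by rewrite Phi_cst.
  - move=> i _ iW [b Ib ->].
    exists (X (xm [set i] 1) * b); first exact: ideal_mull.
    have tm : trivC W (xm [set i] 1).
      apply/trivCP => j; rewrite ffunE inE; case: eqP => // ->.
      by rewrite iW.
    rewrite Phi_mull // Phim_trivC // (bigD1 i) //= big1 => [|j /andP[_ ji]].
      by rewrite ffunE inE eqxx /= expr0 divr1 mulr1.
    by rewrite ffunE inE (negPf ji) /= expr0 divr1.
  - move=> i _ iW [b Ib ->].
    exists (X (ym [set i] 1) * b); first exact: ideal_mull.
    have tm : trivC W (ym [set i] 1).
      apply/trivCP => j; rewrite ffunE inE; case: eqP => // ->.
      by rewrite iW.
    rewrite Phi_mull // Phim_trivC // (bigD1 i) //= big1 => [|j /andP[_ ji]].
      by rewrite ffunE inE eqxx /= expr0 mul1r mulr1.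
    by rewrite ffunE inE (negPf ji) /= expr0 divr1.
  (* The (0,0) entry of a product is a sum of products of entries of its factors, which are (0,0)
     entries of [c * X x] and [X (swapm x) * d], both in [I]. *)
  - move=> _ [b Ib ->]; have [l lI ->] := idemI Ib.
    elim: l lI => [|[c d] l IHl] lI.
      by exists [::]; rewrite ?big_nil ?Phi0.
    have [|l' l'A l'E] := IHl.
      by move=> p pl; apply: lI; rewrite inE pl orbT.
    have [/= Ic Id] := lI _ (mem_head _ _).
    have [s sE] := Phi_mul W c d.
    exists ([seq (Phi W (c * X x), Phi W (X (swapm x) * d)) | x <- s] ++ l').
      move=> p; rewrite mem_cat => /orP[/mapP[x _ ->]|/l'A //].
      split; [exists (c * X x) | exists (X (swapm x) * d)] => //=.
        exact: ideal_mulr.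
      exact: ideal_mull.
    by rewrite big_cons PhiD l'E big_cat big_map sE.
  - exists (Phi W (X u * a * X v)) => //.
    by exists (X u * a * X v) => //; apply: IM.
case=> c Ic c1; apply: (@ideal_unit_entry W c) => //.
have p1 : Phi W (1 : alg) = 1.
  rewrite -(X1 K n) PhiU rmorph1 mul1r Phim_trivC ?big1 // => [i _|].
    by rewrite ffunE /= divr1.
  by apply/trivCP => i _; rewrite ffunE.
have /lam_eq0 : Phi W (c - 1) = 0 by rewrite raddfB /= p1 -c1 subrr.
rewrite lam_additive => /eqP; rewrite subr_eq0 => /eqP ->.
rewrite -(X1 K n) lamU; case: trivCP => [_|[]]; last first.
  by move=> i _; rewrite ffunE.
by congr U; apply/ffunP => i; rewrite !ffunE; case: ifP.
Qed.

(** Induction on the number of [V] with [Q V a] nonzero. [J] stands for any additively closed set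
    containing each I_f that lies in [I]; it will be the sum over the maximal such [f]. *)
Theorem idem_ideal_sum (J : alg -> Prop) :
  J 0 -> (forall a b, J a -> J b -> J (a + b)) ->
  (forall f, (forall b, inIf f b -> I b) -> forall b, inIf f b -> J b) ->
  forall a, I a -> J a.
Proof.
move=> J0 JD Jf a Ia.
pose S b := [set V : {set 'I_n} | Q V b != 0].
have memS b V : (V \in S b) = (Q V b != 0) by rewrite in_set.
have [k] := ubnP #|S a|.
elim: k a Ia => // k IHk a Ia; rewrite ltnS => le.
have [->//|a0] := eqVneq a 0.
have ex0 : Q set0 a != 0 by rewrite Q_set0.
case: (@arg_maxnP _ set0 (fun W : {set 'I_n} => Q W a != 0)
  (fun W => #|W|) ex0) => W QW maxW.
have QUW i : i \notin W -> Q (i |: W) a = 0.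
  move=> iW; apply/eqP; apply: contraT => /maxW /=.
  by rewrite cardsU1 iW add1n ltnn.
pose f : Bn n := [ffun i => i \in W].
have fE i : f i = (i \in W) by rewrite ffunE.
have Qf : inIf f (Q W a) by move=> i; rewrite fE QQ => /QUW.
have If := idem_If fE Ia QW.
rewrite -(subrK (Q W a) a); apply: JD; last by apply: (Jf f).
apply: IHk; first by apply: idealB => //; apply: If.
(* [W] leaves the set, and no [V] enters: if [Q V] kills [a], so does [Q (V :|: W)]. *)
apply: leq_trans le; apply: proper_card; apply/properP; split; last first.
  by exists W; rewrite memS // QB QQ setUid subrr eqxx.
apply/subsetP => V VA; rewrite memS; apply: contraTneq VA => QV.
by rewrite memS QB QQ QV (Q_ker_sub (subsetUl V W) QV) subrr eqxx.
Qed.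

End Ideal.
End Idem.

(** * Sums of the I_f *)

Section Sums.
Variables (K : fieldType) (n : nat).
Local Notation alg := (alg K n).
Local Notation X := (X K).
Implicit Types (a b : alg) (m : mon n) (i j : 'I_n) (W : {set 'I_n}).
Implicit Types (f : Bn n) (C D : {set Bn n}).

Lemma inIf0 f : inIf f (0 : alg).
Proof. by move=> i _; rewrite Q0. Qed.

Lemma inIfD f a b : inIf f a -> inIf f b -> inIf f (a + b).
Proof. by move=> fa fb i fi; rewrite QD fa ?fb ?addr0. Qed.

Lemma inIfM f a b c : inIf f b -> inIf f (a * b * c).
Proof. by move=> fb i fi; apply/Q_ker_mul/fb. Qed.

Lemma inIf_le f g a : leB f g -> inIf f a -> inIf g a.
Proof.
by move/forallP=> fg fa i gi; apply: fa; apply: contraNN gi; apply/implyP.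
Qed.

(** As [y_i^k] kills [a] for large [k], the factor [1 - x_i^k y_i^k], itself in the kernel of [Q
    [set i]], fixes [a]. Such local units make I_f, and hence I_C, idempotent. *)
Lemma left_unit (r : seq 'I_n) a : (forall i, i \in r -> Q [set i] a = 0) ->
  exists2 e, (forall i, i \in r -> Q [set i] e = 0) & e * a = a.
Proof.
elim: r => [|i r IHr] H; first by exists 1; rewrite ?mul1r.
have [|e er ea] := IHr; first by move=> j jr; apply: H; rewrite inE jr orbT.
have [k /(_ k (leqnn k))] := eventually_ym [set i] a.
rewrite H ?mem_head // mulr0 => ya.
exists ((1 - X (xm [set i] k) * X (ym [set i] k)) * e) => [j|]; last first.
  by rewrite -mulrA ea mulrBl mul1r -mulrA -ya mulr0 subr0.
rewrite inE => /predU1P[->|/er]; last exact: Q_ker_mull.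
apply: Q_ker_mulr; rewrite QB X_mul -(X1 K n) !QU; apply/eqP; rewrite subr_eq0.
apply/eqP; congr U; apply/ffunP => l; rewrite !ffunE inE.
by case: eqP => //= _; rewrite /red1 /=; congr (_, _); lia.
Qed.

Lemma inIf_unit f a : inIf f a -> exists2 e, inIf f e & e * a = a.
Proof.
move=> fa; have [|e er ea] := @left_unit [seq i <- enum 'I_n | ~~ f i] a.
  by move=> i; rewrite mem_filter => /andP[/fa].
exists e => // i fi; apply: er; by rewrite mem_filter fi mem_enum.
Qed.

Definition sumIf (C : {set Bn n}) a :=
  exists2 b : Bn n -> alg, (forall f, f \in C -> inIf f (b f)) &
    a = \sum_(f in C) b f.

Lemma ICP C (g : mon n -> K) : IC C g <-> exists2 a, sumIf C a & g =1 coef a.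
Proof.
split=> [[gs [gsP gE]]|[a [b bP ->] gE]].
  have /fin_all_exists[b bP] f : exists b : alg,
      f \in C -> inIf f b /\ gs f =1 coef b.
    have [fC|] := boolP (f \in C); last by exists 0.
    by have /IfP[b fb gb] := gsP f fC; exists b.
  exists (\sum_(f in C) b f).
    by exists b => // f /bP[].
  by move=> m; rewrite gE coef_sum; apply: eq_bigr => f /bP[_ ->].
exists (fun f => coef (b f)); split=> [f fC|m].
  by apply/IfP; exists (b f) => //; apply: bP.
by rewrite gE coef_sum.
Qed.

Lemma sumIf0 C : sumIf C 0.
Proof. by exists (fun=> 0) => [f _|]; [apply: inIf0|rewrite big1]. Qed.

Lemma sumIfD C a b : sumIf C a -> sumIf C b -> sumIf C (a + b).
Proof.
case=> [x xP ->] [y yP ->]; exists (fun f => x f + y f).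
  by move=> f fC; apply: inIfD; [apply: xP|apply: yP].
by rewrite big_split.
Qed.

Lemma sumIfM C a b c : sumIf C b -> sumIf C (a * b * c).
Proof.
case=> [x xP ->]; exists (fun f => a * x f * c).
  by move=> f /xP; apply: inIfM.
by rewrite mulr_sumr mulr_suml.
Qed.

Lemma sub_sumIf C f a : f \in C -> inIf f a -> sumIf C a.
Proof.
move=> fC fa; exists (fun g => if g == f then a else 0).
  by move=> g _; case: eqP => [->|_] //; apply: inIf0.
by rewrite (bigD1 f) //= eqxx big1 ?addr0 // => g /andP[_ /negPf ->].
Qed.

Lemma ev_coef (s : expr K n) : ev s = coef (of_expr s).
Proof. by apply: funext => m; apply: ev_of_expr. Qed.

(** * Passage between coefficient functions and ring elements *)

Section Transfer.
Variable I : (mon n -> K) -> Prop.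

Lemma is_idealP : is_ideal I <->
  (forall g, I g -> elt g) /\ ideal (fun a => I (coef a)).
Proof.
split=> [[Ie I0 ID IZ IM]|[Ie [I0 ID IM]]].
  split=> //; split.
  - by have -> : coef (0 : alg) = (fun=> 0) by apply: funext => m; apply: coef0.
  - move=> a b Ia Ib.
    have -> : coef (a + b) = (fun m => coef a m + coef b m).
      by apply: funext => m; apply: coefD.
    exact: ID.
  -     move=> a b c Ib; have := IM (to_expr a) (to_expr b).
    rewrite !ev_coef !of_expr_emul !to_exprK => /(_ Ib)[Iab _].
    have := IM (to_expr c) (to_expr (a * b)).
    by rewrite !ev_coef !of_expr_emul !to_exprK => /(_ Iab)[_].
have Ic g : I g -> exists2 a, I (coef a) & g = coef a.
  move=> Ig; have [s gs] := Ie g Ig; have gE : g = coef (of_expr s).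
    by rewrite -ev_coef; apply: funext.
  by exists (of_expr s) => //; rewrite -gE.
split=> //.
- by have <- : coef (0 : alg) = (fun=> 0) by apply: funext => m; apply: coef0.
- move=> g h /Ic[a Ia ->] /Ic[b Ib ->].
  have <- : coef (a + b) = (fun m => coef a m + coef b m).
    by apply: funext => m; apply: coefD.
  exact: ID.
- move=> c g /Ic[a Ia ->].
  have <- : coef (U c (mone n) * a) = (fun m => c * coef a m).
    by apply: funext => m; apply: coefC.
  by have := IM (U c (mone n)) a 1 Ia; rewrite mulr1.
- move=> s t; rewrite !ev_coef !of_expr_emul => It; split.
    by have := IM (of_expr s) (of_expr t) 1 It; rewrite mulr1.
  by have := IM 1 (of_expr t) (of_expr s) It; rewrite mul1r.
Qed.

Hypothesis idI : is_ideal I.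

Lemma elt_coef g : I g -> exists2 a, I (coef a) & g = coef a.
Proof.
move=> Ig; have [+ _ _ _ _] := idI => /(_ g Ig)[s gs].
have gE : g = coef (of_expr s).
  by apply: funext => m; rewrite -ev_of_expr.
by exists (of_expr s) => //; rewrite -gE.
Qed.

Lemma idem_idealP : idem_ideal I <-> idem (fun a => I (coef a)).
Proof.
have [_ idS] := (is_idealP).1 idI; have [I0 ID IM] := idS.
split=> [I2 a /I2[k [s [t [st aE]]]]|I2 g].
  exists [seq (of_expr (s l), of_expr (t l)) | l <- enum 'I_k].
    by move=> _ /mapP[j _ ->] /=; have := st j; rewrite !ev_coef.
  apply: coef_inj => m; rewrite aE big_map big_enum coef_sum.
  by apply: eq_bigr => j _; rewrite ev_of_expr of_expr_emul.
split=> [[k [s [t [st gE]]]]|].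
  have -> : g = coef (\sum_(l < k) of_expr (s l) * of_expr (t l)).
    apply: funext => m; rewrite gE coef_sum; apply: eq_bigr => j _.
    by rewrite ev_of_expr of_expr_emul.
  apply: (big_ind (fun a => I (coef a)) I0 ID) => l _.
  apply: (@ideal_mull K n _ idS (of_expr (s l)) (of_expr (t l))).
  by rewrite -ev_coef; case: (st l).
case/elt_coef=> a Ia ->; have [l lI aE] := I2 a Ia.
exists (size l), (fun j : 'I_(size l) => to_expr (nth (0, 0) l j).1).
exists (fun j : 'I_(size l) => to_expr (nth (0, 0) l j).2); split.
  by move=> j; rewrite !ev_coef !to_exprK; apply/lI/mem_nth.
move=> m; rewrite {1}aE (big_nth (0, 0)) big_mkord coef_sum.
apply: eq_bigr => j _.
by rewrite ev_of_expr of_expr_emul !to_exprK.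
Qed.

End Transfer.

Lemma IC_coef C a : IC C (coef a) <-> sumIf C a.
Proof.
rewrite ICP; split=> [[b Cb ab]|Ca]; last by exists a.
by rewrite (coef_inj ab).
Qed.

Lemma IC_ideal C : is_ideal (IC (K := K) C).
Proof.
apply/is_idealP; split=> [g /ICP[a _ ga]|].
  by exists (to_expr a) => m; rewrite ev_of_expr to_exprK.
split=> [|a b|a b c]; rewrite !IC_coef; first exact: sumIf0.
  exact: sumIfD.
exact: sumIfM.
Qed.

Lemma IC_idem C : idem_ideal (IC (K := K) C).
Proof.
apply/(idem_idealP (IC_ideal C)) => a /IC_coef[b bP ->].
have /fin_all_exists[e eP] f : exists e, f \in C -> inIf f e /\ e * b f = b f.
  have [/bP/inIf_unit[e fe eb]|] := boolP (f \in C); last by exists 0.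
  by exists e.
exists [seq (e f, b f) | f <- enum C].
  move=> _ /mapP[f fC ->] /=; rewrite mem_enum in fC.
  have [fe _] := eP f fC; rewrite !IC_coef.
  by split; apply: (sub_sumIf fC) => //; apply: bP.
rewrite big_map big_enum /=; apply: eq_bigr => f /eP[_ ->//].
Qed.

Lemma coefQ_red W a m : coef (Q W a) m != 0 -> redm W m = m.
Proof.
elim/alg_ind: a => [|a b IHa IHb|c m']; first by rewrite Q0 coef0 eqxx.
  rewrite QD coefD; have [->|/IHa//] := eqVneq (coef (Q W a) m) 0.
  by rewrite add0r.
rewrite QU coefU; have [<- _|_] := eqVneq (redm W m') m; last by rewrite eqxx.
by rewrite redmU setUid.
Qed.

(** The witness is the product of the [x_i y_i - 1] over the [i] with [f i] false. Its coefficient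
    at [m] is 1, since every subtracted term is reduced in some coordinate where [m] is not. *)
Lemma exists_inIf f : exists2 a : alg, inIf f a & Q [set i | f i] a != 0.
Proof.
pose r := [seq i <- enum 'I_n | ~~ f i].
pose m : mon n := [ffun i => if f i then (0%N, 0%N) else (1%N, 1%N)].
have rf i : i \in r -> ~~ f i by rewrite mem_filter => /andP[].
exists (kproj r (X m)).
  rewrite (kproj_X K m (filter_uniq _ (enum_uniq 'I_n))).
  apply: tensor_inIf => i.
  rewrite /mono_fac mem_filter mem_enum andbT.
  by case: (f i) => //=; apply: inF_red1.
have QP W s a : Q W (kproj s a) = kproj s (Q W a).
  by elim: s => //= i s IHs; rewrite QB !QQ setUC -QQ IHs.
rewrite QP QU (_ : redm _ m = m); last first.
  by apply/ffunP => i; rewrite !ffunE inE; case: ifP => // ->.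
apply/eqP => /(congr1 (fun a => coef a m)); rewrite coef0; apply/eqP.
suff -> : coef (kproj r (U 1 m)) m = 1 :> K by apply: oner_neq0.
elim: r rf => [|i r IHr] rf /=; first by rewrite coefU eqxx.
have /IHr Pm1 : forall j, j \in r -> ~~ f j.
  by move=> j jr; apply: rf; rewrite inE jr orbT.
rewrite coefB Pm1.
have [->|nz] := eqVneq (coef (Q [set i] (kproj r (X m))) m) 0.
  by rewrite subr0.
have /ffunP/(_ i) := coefQ_red nz.
by rewrite !ffunE inE eqxx (negPf (rf i (mem_head _ _))).
Qed.

(** If no [g] in [D] were above [f], each would vanish at some [i] with [f i] true, so [Q
    [set i | f i]] would kill I_D but not the witness in I_f. *)
Lemma IC_sub_le (C D : {set Bn n}) f : f \in C ->
  (forall g : mon n -> K, IC C g -> IC D g) -> exists2 g, g \in D & leB f g.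
Proof.
move=> fC CD; have [a fa] := exists_inIf f.
have /IC_coef[b bP aE] : IC D (coef a) by apply/CD/IC_coef/(sub_sumIf fC).
have [/exists_inP[g gD fg]|no] := boolP [exists g in D, leB f g].
  by exists g.
case/eqP; rewrite aE raddf_sum /= big1 // => g gD.
have : ~~ leB f g.
  by apply: contraNN no => fg; apply/exists_inP; exists g.
case/forallPn=> i; rewrite negb_imply => /andP[fi gi].
by apply: (Q_ker_sub (W := [set i])); rewrite ?sub1set ?inE // (bP g gD).
Qed.

Lemma leB_refl f : leB f f.
Proof. by apply/forallP => i; apply: implybb. Qed.

Lemma leB_trans f g h : leB f g -> leB g h -> leB f h.
Proof.
move=> /forallP fg /forallP gh; apply/forallP => i; apply/implyP => fi.
by apply: (implyP (gh i)); apply: (implyP (fg i)).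
Qed.

Lemma leB_anti f g : leB f g -> leB g f -> f = g.
Proof.
move=> /forallP fg /forallP gf; apply/ffunP => i; apply/idP/idP.
  exact/implyP.
exact/implyP.
Qed.

(** Two comparisons give [f <= g <= f'] with [g] in [D] and [f], [f'] in [C]; incomparability in [C]
    forces [f = g = f']. *)
Lemma IC_antichain_sub (C D : {set Bn n}) : antichain C ->
  (forall g : mon n -> K, IC C g <-> IC D g) -> C \subset D.
Proof.
move=> aC CD; apply/subsetP => f fC.
have [|g gD fg] := IC_sub_le fC (D := D); first by move=> h /CD.
have [|f' f'C gf'] := IC_sub_le gD (D := C); first by move=> h /CD.
have ff' : f = f'.
  apply/eqP; apply/negPn/negP => /(aC f f' fC f'C)[/negP + _]; apply.
  exact: leB_trans gf'.
by rewrite (leB_anti (f := f) (g := g)) // ff'.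
Qed.

Lemma antichain_inj (C D : {set Bn n}) : antichain C -> antichain D ->
  (forall g : mon n -> K, IC C g <-> IC D g) -> C = D.
Proof.
move=> aC aD CD; apply/eqP; rewrite eqEsubset !IC_antichain_sub // => g.
by split=> /CD.
Qed.

Lemma idem_ideal_IC (I : (mon n -> K) -> Prop) : is_ideal I -> idem_ideal I ->
  exists2 C : {set Bn n}, antichain C & forall g, I g <-> IC C g.
Proof.
move=> idI /(idem_idealP idI) I2.
have [_ idS] := (is_idealP I).1 idI; have [I0 ID IM] := idS.
pose T := [set f : Bn n | `[< forall b, inIf f b -> I (coef b) >]].
(* The maximal [f] with I_f inside [I]; by monotonicity of I_f they give the same sum as all of
   [T]. *)
pose C := [set f in T | [forall g in T, leB f g ==> (g == f)]].
exists C.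
  move=> f g; rewrite !inE.
  move=> /andP[fT /forall_inP fm] /andP[gT /forall_inP gm] fg.
  split; apply/negP => le.
    by have := implyP (fm g _) le; rewrite inE gT eq_sym (negPf fg) => /(_ isT).
  by have := implyP (gm f _) le; rewrite inE fT (negPf fg) => /(_ isT).
have CI a : sumIf C a -> I (coef a).
  case=> b bP ->; apply: (big_ind (fun a => I (coef a)) I0 ID) => f fC.
  have := bP f fC; move: fC; rewrite !inE => /andP[/asboolP fI _]; exact: fI.
have TC f : f \in T -> exists2 g, g \in C & leB f g.
  move=> fT; have Pf : (f \in T) && leB f f by rewrite fT leB_refl.
  case: (@arg_maxnP _ f (fun g => (g \in T) && leB f g)
    (fun g : Bn n => #|[set i | g i]|) Pf) => g /andP[gT fg] gm.
  exists g => //; rewrite inE gT; apply/forall_inP => h hT; apply/implyP => gh.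
  have sub : [set i | g i] \subset [set i | h i].
    by apply/subsetP => i; rewrite !inE; apply/implyP; apply: (forallP gh).
  have /= := gm h; rewrite hT (leB_trans fg gh) => /(_ isT) le.
  have /eqP/setP gh' : [set i | g i] == [set i | h i].
    by rewrite eqEcard sub.
  by apply/eqP/ffunP => i; have := gh' i; rewrite !inE.
move=> g; split=> [/(elt_coef idI)[a Ia ->]|/ICP[a Ca ga]]; last first.
  by have -> : g = coef a by [apply: funext]; apply: CI.
apply/IC_coef.
apply: (@idem_ideal_sum K n (fun a => I (coef a)) idS I2 (sumIf C)) => //.
- exact: sumIf0.
- by move=> *; apply: sumIfD.
move=> f fI b fb; have [|h hC fh] := TC f; first by rewrite inE; apply/asboolP.
by apply: (sub_sumIf hC); apply: inIf_le fb.
Qed.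

(** * The involution *)

Definition swapa a : alg := ext (fun m c => U c (swapm m)) a.

Lemma swapa_additive : zmod_morphism swapa.
Proof. by apply: ext_additive => m x y; apply: U_additive. Qed.

HB.instance Definition _ :=
  GRing.isZmodMorphism.Build alg alg swapa swapa_additive.

Lemma swapaU c m : swapa (U c m) = U c (swapm m).
Proof. by rewrite /swapa extU // => m' x y; apply: U_additive. Qed.

Lemma Q_swapa W a : Q W (swapa a) = swapa (Q W a).
Proof.
elim/alg_ind: a => [|a b IHa IHb|c m]; first by rewrite Q0 raddf0 Q0.
  by rewrite QD !(raddfD swapa) QD IHa IHb.
by rewrite QU !swapaU QU redm_swap.
Qed.

Lemma coef_swapa a m : coef (swapa a) m = coef a (swapm m).
Proof.
elim/alg_ind: a => [|a b IHa IHb|c m']; first by rewrite raddf0 !coef0.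
  by rewrite (raddfD swapa) !coefD IHa IHb.
rewrite swapaU !coefU; congr (_ *+ _); congr nat_of_bool.
by apply/eqP/eqP => [<-|->]; rewrite swapmK.
Qed.

(** Swapping exponents commutes with every [Q W], so it preserves each I_f. *)
Lemma IC_swap C (g : mon n -> K) : IC C g -> IC C (eta_inv g).
Proof.
case/ICP=> _ [b bP ->] gE; apply/ICP; exists (swapa (\sum_(f in C) b f)).
  exists (fun f => swapa (b f)); last by rewrite raddf_sum.
  by move=> f fC i fi; rewrite Q_swapa (bP f fC i fi) raddf0.
by move=> m; rewrite coef_swapa /eta_inv gE.
Qed.

Lemma eta_IC C (g : mon n -> K) :
  (exists h, IC C h /\ forall m, g m = eta_inv h m) <-> IC C g.
Proof.
split=> [[h [Ch gh]]|Cg].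
  by have -> : g = eta_inv h by [apply: funext]; apply: IC_swap.
exists (eta_inv g); split; first exact: IC_swap.
by move=> m; rewrite /eta_inv swapmK.
Qed.

(** * Counting idempotent ideals by antichains of subsets *)

Definition bset (f : Bn n) : {set 'I_n} := [set i | f i].
Definition bfun (A : {set 'I_n}) : Bn n := [ffun i => i \in A].

Lemma bsetK : cancel bset bfun.
Proof. by move=> f; apply/ffunP => i; rewrite ffunE inE. Qed.

Lemma bfunK : cancel bfun bset.
Proof. by move=> A; apply/setP => i; rewrite inE ffunE. Qed.

Lemma leB_bfun A B : leB (bfun A) (bfun B) = (A \subset B).
Proof.
apply/forallP/subsetP => H i; last by rewrite !ffunE; apply/implyP/H.
by have := H i; rewrite !ffunE => /implyP.
Qed.

(** Literally the set counted by [dedekind], so that ['I_#|antis|] and ['I_(dedekind n)] are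
    convertible. *)
Let antis : {set {set {set 'I_n}}} := [set A : {set {set 'I_n}} |
  [forall X in A, forall Y in A, (X != Y) ==> ~~ (X \subset Y)]].

Lemma antisP A : A \in antis -> antichain (bfun @: A).
Proof.
rewrite inE => /forall_inP H _ _ /imsetP[x xA ->] /imsetP[y yA ->].
rewrite (can_eq bfunK) !leB_bfun => xy.
have := implyP (forall_inP (H x xA) y yA) xy.
by have := implyP (forall_inP (H y yA) x xA); rewrite eq_sym => /(_ xy).
Qed.

Lemma antichain_antis C : antichain C -> bset @: C \in antis.
Proof.
move=> aC; rewrite inE; apply/forall_inP => _ /imsetP[f fC ->].
apply/forall_inP => _ /imsetP[g gC ->]; apply/implyP.
rewrite (can_eq bsetK) => fg; have [+ _] := aC f g fC gC fg.
by rewrite -leB_bfun !bsetK.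
Qed.

Lemma idem_ideals_card :
  exists Phi : 'I_(dedekind n) -> ((mon n -> K) -> Prop),
    [/\ forall j : 'I_(dedekind n), is_ideal (Phi j) /\ idem_ideal (Phi j),
        forall j k : 'I_(dedekind n), (forall g, Phi j g <-> Phi k g) -> j = k
      & forall I, is_ideal I -> idem_ideal I ->
          exists j : 'I_(dedekind n), forall g, I g <-> Phi j g].
Proof.
pose A (j : 'I_#|antis|) : {set {set 'I_n}} := enum_val j.
have AP (j : 'I_#|antis|) : antichain (bfun @: A j) by apply/antisP/enum_valP.
exists (fun j : 'I_#|antis| => IC (K := K) (bfun @: A j)); split.
- by move=> j; split; [apply: IC_ideal|apply: IC_idem].
- move=> j k /(antichain_inj (AP j) (AP k)) /(imset_inj (can_inj bfunK)).
  exact: enum_val_inj.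
- move=> I idI I2; have [C aC IE] := idem_ideal_IC idI I2.
  have CA := antichain_antis aC.
  exists (enum_rank_in CA (bset @: C)); rewrite /A enum_rankK_in //.
  rewrite -imset_comp (eq_imset _ bsetK) imset_id; exact: IE.
Qed.

End Sums.

End OneSided.

Theorem theorem7p1 (K : fieldType) (n : nat) :
  [/\ (* (1) C |-> I_C is a bijection C_n -> idem_ideal ideals *)
      (forall C : {set Bn n}, antichain C ->
          is_ideal (IC (K := K) C) /\ idem_ideal (IC (K := K) C)),
      (forall C D : {set Bn n}, antichain C -> antichain D ->
          (forall g : mon n -> K, IC C g <-> IC D g) -> C = D),
      (forall I : (mon n -> K) -> Prop, is_ideal I -> idem_ideal I ->
          exists2 C : {set Bn n}, antichain C & forall g, I g <-> IC C g),
      (* (2) the set of idem_ideal ideals is finite of cardinality d_n *)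
      (exists Phi : 'I_(dedekind n) -> ((mon n -> K) -> Prop),
          [/\ forall j, is_ideal (Phi j) /\ idem_ideal (Phi j),
              forall j k, (forall g, Phi j g <-> Phi k g) -> j = k
            & forall I, is_ideal I -> idem_ideal I ->
                exists j, forall g, I g <-> Phi j g])
    & (* (3) eta(I) = I for every idem_ideal ideal *)
      forall I : (mon n -> K) -> Prop, is_ideal I -> idem_ideal I ->
        forall g : mon n -> K,
          (exists h, I h /\ forall m, g m = eta_inv h m) <-> I g].
Proof.
split.
- by move=> C _; split; [apply: OneSided.IC_ideal|apply: OneSided.IC_idem].
- exact: OneSided.antichain_inj.
- exact: OneSided.idem_ideal_IC.
- exact: OneSided.idem_ideals_card.
- move=> I idI I2 g; have [C _ IE] := OneSided.idem_ideal_IC idI I2.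
  rewrite IE -OneSided.eta_IC.
  by split=> -[h [hI gE]]; exists h; split=> //; apply/IE.
Qed.
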